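(* For every $\epsilon>0$ there is a polynomial-time algorithm for $\mathsf{StackMST}(0,0)$ restricted to instances whose red tree is a path, which returns a solution of revenue $r$ with $r^*/r\le 3/2+\epsilon$, where $r^*$ is the optimal revenue.
   Context: Budgeted Stackelberg MST game $\mathsf{StackMST}(\gamma,\Delta)$: we are given a tree $T=(V,E(T))$ on $n$ vertices whose (red) edges have fixed costs $c(e)\ge 0$, a non-negative activation cost $\gamma(e)$ for every pair $e=\{u,v\}\notin E(T)$ of vertices (potential blue edges), and a budget $\Delta$. The leader selects a set $F$ of pairs not in $E(T)$ with $\sum_{e\in F}\gamma(e)\le\Delta$ and a price function $p:F\to\mathbb{R}^+$. The follower then computes a minimum spanning tree $M(F,p)$ of the graph $(V,E(T)\cup F)$, where red edges are weighted by $c$ and edges of $F$ by $p$; among several minimum spanning trees the follower picks one maximizing the leader's revenue. The leader's revenue is $\sum_{e\in F\cap M(F,p)}p(e)$, and the goal is to maximize it. $\mathsf{StackMST}(0,0)$ denotes the special case $\gamma\equiv 0$, $\Delta=0$, i.e. the leader may add any set of new edges between vertices of $V$ at no cost. *)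

(* Defs.v *)
From HB Require Import structures.
From mathcomp Require Import all_boot all_order all_algebra.
From mathcomp Require Import reals.
Set Implicit Arguments. Unset Strict Implicit. Unset Printing Implicit Defensive.
Import Order.TTheory GRing.Theory Num.Theory.
Local Open Scope ring_scope.

(* Model of computation: a unit-cost RAM over natural numbers with addition,  *)
(* truncated subtraction, indirect addressing and conditional jumps.  (This  *)
(* model is polynomially equivalent to Turing machines.)                      *)

Inductive instr : Type :=
| IConst of nat & nat
| IAdd of nat & nat & nat
| ISub of nat & nat & nat
| ILoad of nat & nat
| IStore of nat & nat
| IJz of nat & nat
| IJmp of nat
| IHalt.

Record config : Type := Config { pc : nat; mem : nat -> nat }.

Definition upd (m : nat -> nat) (r v : nat) : nat -> nat :=
  fun x => if x == r then v else m x.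

(* One step; [None] means the machine has halted (an [IHalt] instruction or a
   program counter outside the program). *)
Definition step (P : seq instr) (c : config) : option config :=
  let m := mem c in
  let nx := (pc c).+1 in
  match nth IHalt P (pc c) with
  | IConst r k => Some (Config nx (upd m r k))
  | IAdd r a b => Some (Config nx (upd m r (m a + m b)%N))
  | ISub r a b => Some (Config nx (upd m r (m a - m b)%N))
  | ILoad r a => Some (Config nx (upd m r (m (m a))))
  | IStore a b => Some (Config nx (upd m (m a) (m b)))
  | IJz a t => Some (Config (if m a == 0%N then t else nx) m)
  | IJmp t => Some (Config t m)
  | IHalt => None
  end.

Fixpoint runs (P : seq instr) (k : nat) (c : config) : option config :=
  match k with
  | 0 => if step P c is None then Some c else None
  | k'.+1 => if step P c is Some c1 then runs P k' c1 else None
  end.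

Definition halts_within (P : seq instr) (c : config) (T : nat) (c' : config) :=
  exists2 k, (k <= T)%N & runs P k c = Some c'.

Definition init_config (inp : seq nat) : config :=
  Config 0 (fun x => nth 0%N (size inp :: inp) x).

Definition output (c : config) : seq nat :=
  [seq mem c i | i <- iota 1 (mem c 0)].

Definition insize (inp : seq nat) : nat :=
  \sum_(x <- inp) (trunc_log 2 x).+1.

(* Vertices are 'I_n; an (unordered) pair {u,v} is represented by (u,v) with  *)
(* u < v.  Red edges are the path edges {i, i+1}; the red cost of {i,i+1} is  *)
(* c i.                                                                       *)

Section Game.
Variable R : realType.
Variable n : nat.
Notation pair := ('I_n * 'I_n)%type.

Definition red (e : pair) : bool := ((e.1 : nat).+1 == e.2).
Definition blue (e : pair) : bool := ((e.1 : nat).+1 < e.2)%N.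

Definition graph_edges (F : {set pair}) : {set pair} := [set e | red e] :|: F.

Definition adj (S : {set pair}) : rel 'I_n :=
  fun x y => ((x, y) \in S) || ((y, x) \in S).

Definition is_sptree (E S : {set pair}) : bool :=
  [&& S \subset E, #|S| == n.-1 & [forall x, forall y, connect (adj S) x y]].

Definition weight (c : nat -> R) (p : pair -> R) (e : pair) : R :=
  if red e then c e.1 else p e.

Definition is_mst (c : nat -> R) (F : {set pair}) (p : pair -> R)
    (S : {set pair}) : bool :=
  is_sptree (graph_edges F) S &&
  [forall S' : {set pair}, is_sptree (graph_edges F) S' ==>
     (\sum_(e in S) weight c p e <= \sum_(e in S') weight c p e)].

(* Leader's revenue: the follower chooses, among all minimum spanning trees,
   one maximizing the leader's revenue. *)
Definition revenue (c : nat -> R) (F : {set pair}) (p : pair -> R) : R :=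
  \big[Num.max/0]_(S : {set pair} | is_mst c F p S)
     \sum_(e in S :&: F) p e.

Definition feasible (F : {set pair}) (p : pair -> R) : Prop :=
  forall e, e \in F -> blue e /\ 0 <= p e.

End Game.

(* An instance with n vertices and red costs c_i = a_i / b_i (i < n-1) is     *)
(* encoded by the word list  n, a_0, b_0, ..., a_{n-2}, b_{n-2}.              *)

Definition encode_instance (n : nat) (cs : seq (nat * nat)) : seq nat :=
  n :: flatten [seq [:: ab.1; ab.2] | ab <- cs].

Definition valid_instance (n : nat) (cs : seq (nat * nat)) : bool :=
  (size cs == n.-1) && all (fun ab => (0 < ab.2)%N) cs.

Definition cost_of {R : realType} (cs : seq (nat * nat)) (i : nat) : R :=
  let ab := nth (0%N, 1%N) cs i in (ab.1)%:R / (ab.2)%:R.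

(* A solution is a list of quadruples ((u, v), (a, b)): blue edge {u,v} with
   price a / b.  It is encoded as the flat word list u, v, a, b, ... *)
Definition encode_solution (qs : seq ((nat * nat) * (nat * nat))) : seq nat :=
  flatten [seq [:: q.1.1; q.1.2; q.2.1; q.2.2] | q <- qs].

Definition valid_solution (n : nat) (qs : seq ((nat * nat) * (nat * nat))) : bool :=
  uniq [seq q.1 | q <- qs] &&
  all (fun q => [&& (q.1.1.+1 < q.1.2)%N, (q.1.2 < n)%N & (0 < q.2.2)%N]) qs.

Definition sol_F (n : nat) (qs : seq ((nat * nat) * (nat * nat))) : {set 'I_n * 'I_n} :=
  [set e : 'I_n * 'I_n | ((e.1 : nat), (e.2 : nat)) \in [seq q.1 | q <- qs]].

Definition sol_p {R : realType} (n : nat) (qs : seq ((nat * nat) * (nat * nat)))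
    (e : 'I_n * 'I_n) : R :=
  let q := nth ((0%N, 0%N), (0%N, 1%N)) qs
               (index ((e.1 : nat), (e.2 : nat)) [seq q.1 | q <- qs]) in
  (q.2.1)%:R / (q.2.2)%:R.

(* Main.v *)
Require Import Defs.
From HB Require Import structures.
From mathcomp Require Import all_boot all_order all_algebra.
From mathcomp Require Import reals.
From mathcomp Require Import zify ring lra.
From Stdlib Require Import FunctionalExtensionality.
Set Implicit Arguments. Unset Strict Implicit. Unset Printing Implicit Defensive.
Import Order.TTheory GRing.Theory Num.Theory.

(** Order the red edges by cost.  A red edge that is not a local minimum is
    replaced, at its own price, by a blue edge of length two towards a cheaper
    neighbour, so that only local minima are lost.  A local minimum [x] next to
    an edge [y] whose other neighbour is cheaper than [x] may be sold as well if
    the price of [y] is lowered to that of [x]; the loss is then [c y - c x].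
    Walking away from the cheapest edge, of cost [m], every loss is charged to
    three times as much cost, which gives a revenue [r] with [3 r >= 2 S - 2 m],
    where [S] is the sum of all costs.

    Since the red path is a spanning tree, the optimum is at most [S - m] if the
    optimal tree contains a red edge.  Otherwise the ends of the cheapest edge
    are joined by blue edges of price at most [m]; exchanging these with edges of
    the red path shows that, in some block of three consecutive edges containing
    the cheapest one, the optimum loses at least the excess over [m] of the
    largest edge.  Selling such a block entirely at price [m], with one blue edge
    of length three, gives [3 r >= 2 S - 2 T + 9 m], where [T] is the cost of the
    block.  The better of
    the two solutions is within a factor [3/2] of the optimum.

    The machine multiplies all costs by the product of the denominators, so that
    every decision compares integers. *)

(** * Prices and losses *)

(** A blue edge of length two sells a red edge at its own price when the other red edge it spans is
    already joined at that price. A local minimum has no such neighbour, which is why all losses sit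
    there. The deficit [2 m] in the first bound comes from the cheapest edge alone: it may lose all
    of [m], and it belongs to neither of the two scans that start beside it. Against an optimum that
    contains a red edge this deficit is harmless, since [2 S - 2 m] is twice [S - m]; only an
    all-blue optimum calls for the flattened block. The machine never computes the two revenues. It
    compares the two guarantees, by testing the smallest block sum against [11 m / 2], and this
    suffices because the minimal block serves for whichever block the optimum singles out. Every
    price is the cost of some red edge, so prices are printed by copying input fractions, and the
    integers obtained by clearing denominators occur in comparisons only. Minimality of the tree is
    checked through the criterion that the ends of every edge of the graph are joined by tree edges
    that are no heavier. *)

Module Pricing.

Ltac iflia := repeat match goal with
  | |- context [if ?b then _ else _] => case: (boolP b) => ?
  end; lia.

Section Rule.
Variables (N : nat) (c : nat -> nat) (fl : pred nat).

(* [j] precedes [i] in the order of costs, ties broken by position. *)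
Definition less j i := (j < N) && ((c j < c i) || ((c j == c i) && (j < i))).
(** The ends of the path need no special case: at [0] the predecessor is [0] itself, which does not
    precede itself, and at the right end the bound inside [less] rules out [i.+1]. *)
Definition local_min i := [&& i < N, ~~ less i.-1 i & ~~ less i.+1 i].
(* A local minimum [i] and its neighbour [y] can both be sold at the price of [i]
   as soon as the edge on the other side of [y] precedes [i]; this beats selling
   [y] alone at its own price when [y] costs less than twice [i]. *)
Definition eligible_right i := [&& local_min i, less i.+2 i & c i.+1 < c i + c i].
Definition eligible_left i := [&& local_min i, less i.-2 i & c i.-1 < c i + c i].
(** Of two eligible neighbours the cheaper one is used, so that the smaller of the two losses is
    incurred. *)
Definition trick_right i := eligible_right i && (~~ eligible_left i || (c i.+1 <= c i.-1)).
Definition trick_left i := eligible_left i && ~~ trick_right i.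

(* The tree edge replacing the red edge [i].  A trick on the right of [i] uses
   both blue edges of length two around the ends of [i.+1]; the one that [i.+1]
   does not use goes to [i].  [fl] marks the flattened block of [flat_at]. *)
Definition tree_edge i : nat * nat :=
  if local_min i then
    if trick_right i then (i.+1, i.+3) else
    if trick_left i then (i.-1, i.+1) else
    if fl i then (i, i.+3) else (i, i.+1)
  else if less i.-1 i then (i.-1, i.+1) else (i, i.+2).

(** A neighbour lowered by a trick takes the price of the local minimum that performs it. The order
    of the tests is immaterial, as tricks from both sides of the same edge exclude each other (see
    [sum_pay]). *)
Definition price_idx i : nat :=
  if local_min i then i else
  if (0 < i) && trick_right i.-1 then i.-1 else
  if trick_left i.+1 then i.+1 else i.

Definition keeps_red i := [&& local_min i, ~~ trick_right i, ~~ trick_left i & ~~ fl i].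

Definition pay i := if keeps_red i then 0 else c (price_idx i).

Definition loss i :=
  if local_min i then
    if trick_right i then c i.+1 - c i else if trick_left i then c i.-1 - c i else
    if fl i then 0 else c i
  else 0.

Lemma local_min_pred i : local_min i -> 0 < i -> ~~ local_min i.-1.
Proof. case: i => // i; rewrite /local_min /less /= => h _; lia. Qed.

Lemma local_min_succ i : local_min i -> ~~ local_min i.+1.
Proof. by move=> h; apply/negP => /local_min_pred /= /(_ isT); rewrite h. Qed.

Lemma loss_le i : local_min i -> loss i <= c i.
Proof. by move=> h; rewrite /loss h /trick_left /trick_right /eligible_right /eligible_left
  h; iflia. Qed.

(** Either the left trick is eligible, and the trick actually used loses at most [c i.-1 - c i]; or
    [c i.-1] is at least twice [c i], and a loss of at most [c i] already fits. *)
Lemma loss_le_left i : local_min i -> 1 < i -> less i.-2 i -> c i + loss i <= c i.-1.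
Proof.
move=> h i1 h2; rewrite /loss h /trick_left /trick_right /eligible_right /eligible_left h h2.
by move: h; rewrite /local_min /less; iflia.
Qed.

Lemma loss_le_right i : local_min i -> less i.+2 i -> c i + loss i <= c i.+1.
Proof.
move=> h h2; rewrite /loss h /trick_left /trick_right /eligible_right /eligible_left h h2.
by move: h; rewrite /local_min /less; move: h2; rewrite /less; iflia.
Qed.

Lemma sum_shift (F : nat -> nat) n : F 0 = 0 -> F n = 0 ->
  \sum_(0 <= i < n) F i.+1 = \sum_(0 <= i < n) F i.
Proof.
move=> F0 Fn; transitivity (\sum_(0 <= i < n.+1) F i).
  by rewrite big_nat_recl // F0.
by rewrite big_nat_recr //= Fn addn0.
Qed.

(** A trick lowers the price of a neighbour, while [loss] records the drop at the local minimum; the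
    two accounts differ by a shift of index. No edge [i] is lowered twice: a trick from its left
    needs [i.+1] to precede [i.-1], one from its right needs the converse. *)
Lemma sum_pay : \sum_(0 <= i < N) c i
  = \sum_(0 <= i < N) pay i + \sum_(0 <= i < N) loss i.
Proof.
(* [a i] is the drop at [i] caused by a right trick of [i.-1], [b i] the drop at [i.-1] caused by a
   left trick of [i], and [r i] the cost of a red edge kept. [ea] and [eb] move a drop between the
   edge where it happens and the local minimum that causes it. *)
pose a i := if (0 < i) && trick_right i.-1 then c i - c i.-1 else 0.
pose b i := if trick_left i then c i.-1 - c i else 0.
pose r i := if keeps_red i then c i else 0.
have ea : \sum_(0 <= i < N) a i = \sum_(0 <= i < N) a i.+1.
  rewrite sum_shift // /a /trick_right /eligible_right /local_min /less /=; iflia.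
have eb : \sum_(0 <= i < N) b i = \sum_(0 <= i < N) b i.+1.
  rewrite sum_shift // /b /trick_left /eligible_left /local_min /less /=; iflia.
have -> : \sum_(0 <= i < N) loss i
    = \sum_(0 <= i < N) a i + \sum_(0 <= i < N) b i.+1 + \sum_(0 <= i < N) r i.
  rewrite -eb ea -!big_split /=; apply: eq_bigr => i _.
  rewrite /loss /a /b /r /keeps_red /trick_left /=.
  have h1 : trick_right i -> local_min i by rewrite /trick_right /eligible_right; lia.
  have h2 : eligible_left i -> local_min i by rewrite /eligible_left; lia.
  iflia.
rewrite -!big_split /= !big_nat; apply: eq_bigr => i /= iN.
rewrite /pay /price_idx /a /b /r.
case: (boolP (local_min i)) => h.
  have h1 : ~~ ((0 < i) && trick_right i.-1).
    by apply/negP => /andP[i0]; rewrite /trick_right /eligible_right (negbTE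
      (local_min_pred h i0)).
  have h2 : ~~ trick_left i.+1 by rewrite /trick_left /eligible_left (negbTE
    (local_min_succ h)).
  by rewrite (negbTE h1) (negbTE h2) /keeps_red h /=; iflia.
rewrite /keeps_red (negbTE h) /=.
case: ifP => h1.
  have h2 : ~~ trick_left i.+1.
    move: h1; rewrite /trick_left /trick_right /eligible_right /eligible_left /less; case:
      (i) => //= k; lia.
  rewrite (negbTE h2); move: h1; rewrite /trick_right /eligible_right /less /local_min /less.
  case: (i) => //= k; lia.
case: ifP => h2; last by lia.
move: h2; rewrite /trick_left /eligible_left /local_min /less /=; lia.
Qed.

End Rule.

(* [f k] and [loss k] are the cost and the loss of the edge at distance [k] from a
   base edge preceding all those on its side.  The induction keeps a surplus
   [2 (f k - loss k)] at every local minimum [k]. *)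
Lemma scan K (f loss : nat -> nat) (L : pred nat) :
  (forall k, ~~ L k -> loss k = 0) -> (forall k, L k -> loss k <= f k) ->
  (forall k, 0 < k <= K -> L k -> [/\ 1 < k, ~~ L k.-1 &
    [\/ f k + loss k <= f k.-1,
        [/\ 2 < k, L k.-2, f k.-2 + loss k.-2 <= f k.-1 & f k <= f k.-2]
      | [/\ 2 < k, ~~ L k.-2, f k <= f k.-2 & f k <= f k.-1]]]) ->
  3 * \sum_(1 <= j < K.+1) loss j <= \sum_(1 <= j < K.+1) f j.
Proof.
move=> L0 Lle H; pose S g k := \sum_(1 <= j < k.+1) g j : nat.
have S0 g : S g 0 = 0 by rewrite /S big_geq.
have SS g k : S g k.+1 = S g k + g k.+1 by rewrite /S big_nat_recr.
suff P k : k <= K -> 3 * S loss k <= S f k /\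
    (0 < k -> L k -> 3 * S loss k + 2 * f k <= S f k + 2 * loss k).
  by have [] := P K (leqnn K).
have [m] := ubnP k; elim: m k => // m IH [|k] km kK; first by rewrite !S0.
have {}IH j : j <= k -> 3 * S loss j <= S f j /\
    (0 < j -> L j -> 3 * S loss j + 2 * f j <= S f j + 2 * loss j).
  by move=> jk; apply: IH; lia.
case Lk: (L k.+1); last first.
  split=> //; have [] := IH k (leqnn k); rewrite !SS (L0 k.+1) ?Lk //; lia.
have := Lle _ Lk; have := H k.+1 _ Lk; rewrite kK /= => /(_ isT)[k1 nL] h le.
case: k => // k in km kK IH Lk k1 nL h le *.
rewrite /= in h nL.
suff : 3 * S loss k.+2 + 2 * f k.+2 <= S f k.+2 + 2 * loss k.+2 by split=> //; lia.
(* The loss and the surplus of the current local minimum are paid by the previous edge alone; or by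
   the previous edge together with the surplus stored at the local minimum two steps back; or by the
   two previous edges, which lose nothing and cost at least as much as the current one. *)
rewrite !SS (L0 _ nL); case: h.
- by have [] := IH k (leqW (leqnn k)); lia.
- case=> k2 Lk'; have [_] := IH k (leqW (leqnn k)).
  have k0 : 0 < k by lia.
  move=> /(_ k0 Lk'); have := Lle _ Lk'; lia.
case=> k2 nL' h1 h2; case: k => // k in km kK IH Lk k1 nL le k2 nL' h1 h2 *.
have [] := IH k (leqW (leqW (leqnn k))); rewrite !SS (L0 _ nL'); lia.
Qed.

Definition block_ok (N g u : nat) : bool := [&& g <= u.+2, u <= g & u.+2 < N].
Definition block_sum (c : nat -> nat) u : nat := c u + (c u.+1 + c u.+2).
Definition in_block (fl : bool) (v i : nat) : bool := [&& fl, v <= i & i <= v.+2].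
(** Redirecting indices lets flattened costs, and later the fractions printed as prices, be read off
    the unchanged data. *)
Definition block_rep (fl : bool) (v g i : nat) : nat := if in_block fl v i then g else i.
(* The edges of the block [v, v.+1, v.+2] are sold at the price of [g]. *)
Definition flat_cost (c : nat -> nat) g fl v i := c (block_rep fl v g i).
Definition flat_at (fl : bool) (v : nat) : pred nat := [pred i | fl && (i == v)].

(** Taking the leftmost of the cheapest edges makes [g] precede all others for [less], whose ties
    are broken by position. *)
Definition leftmost_min (N : nat) (c : nat -> nat) g :=
  [/\ g < N, forall j, j < g -> c g < c j & forall j, j < N -> c g <= c j].

(* A flattened block guarantees [2 S - 2 T + 9 c g] for three times the revenue,
   where [T] is the sum over the block, and no block [2 S - 2 c g]; the former is
   at least the latter iff [2 T <= 11 c g]. *)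
Definition block_choice (N : nat) (c : nat -> nat) g (fl : bool) v :=
  if fl then [/\ block_ok N g v, 2 * block_sum c v <= 11 * c g
    & forall u, block_ok N g u -> block_sum c v <= block_sum c u]
  else forall u, block_ok N g u -> 11 * c g < 2 * block_sum c u.

End Pricing.
Import Pricing.

Section Loss.
Variables (N : nat) (c : nat -> nat) (fl : pred nat).
Local Notation less := (less N c).
Local Notation local_min := (local_min N c).
Local Notation loss := (loss N c fl).

(** This is [scan] along distances from [r]. If the edge two steps back precedes the current local
    minimum, [loss_le_left] applies. Otherwise the current one precedes it, and if that edge is
    itself a local minimum, [loss_le_right] applies there, with the current edge as the preceding
    far edge. *)
Lemma loss_right r : (forall j, r < j < N -> less r j) ->
  3 * \sum_(r.+1 <= i < N) loss i <= \sum_(r.+1 <= i < N) c i.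
Proof.
move=> base; have [Nr|rN] := leqP N r; first by rewrite !big_geq //; lia.
have shift g : \sum_(r.+1 <= i < N) g i = \sum_(1 <= j < (N.-1 - r).+1) g (r + j) :> nat.
  rewrite -{1}[r.+1]add1n big_addn -subSn; last by lia.
  rewrite prednK; last by lia.
  by apply: eq_bigr => i _; rewrite addnC.
rewrite !shift; apply: (scan (L := fun j => local_min (r + j))) => [k|k|k /andP[k0 kK]].
- by rewrite /Pricing.loss => /negbTE ->.
- exact: loss_le.
move=> L; have k1 : 1 < k.
  have [//|k1] := ltnP 1 k; have e : k = 1 by lia.
  move: L; rewrite e addn1 /Pricing.local_min /=; case/and3P=> rN' + _.
  by rewrite base ?ltnSn.
case: k k0 kK L k1 => [|[|k]] // _ kK L _; rewrite /= !addnS in L *.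
split=> //; first by have := local_min_pred L isT.
have nl : ~~ less (r + k).+1 (r + k).+2 by case/and3P: L.
have [l1|l1] := boolP (less (r + k) (r + k).+2).
  by constructor 1; rewrite addnC addnC; apply: loss_le_left.
have k0 : 0 < k.
  case: k kK L l1 {nl} => // kK L; rewrite addn0 base //; lia.
case: (boolP (local_min (r + k))) => L'; [constructor 2|constructor 3]; split=> //.
- apply: loss_le_right => //; move: l1 L; rewrite /Pricing.local_min /Pricing.less; lia.
- move: l1 L; rewrite /Pricing.local_min /Pricing.less; lia.
- move: l1 L; rewrite /Pricing.local_min /Pricing.less; lia.
- move: nl L; rewrite /Pricing.local_min /Pricing.less; lia.
Qed.

Lemma loss_left l : l < N -> (forall j, j < l -> less l j) ->
  3 * \sum_(0 <= i < l) loss i <= \sum_(0 <= i < l) c i.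
Proof.
move=> lN base.
have shift g : \sum_(0 <= i < l) g i = \sum_(1 <= j < l.+1) g (l - j) :> nat.
  by rewrite big_nat_rev big_add1 /= add0n.
rewrite !shift; apply: (scan (L := fun j => local_min (l - j))) => [k|k|k /andP[k0 kl]].
- by rewrite /Pricing.loss => /negbTE ->.
- exact: loss_le.
move=> L; have k1 : 1 < k.
  have [//|k1] := ltnP 1 k; have e : k = 1 by lia.
  move: L; rewrite e /Pricing.local_min /=; case/and3P=> _ _.
  have -> : (l - 1).+1 = l by lia.
  by rewrite base //; lia.
have {kl} [i il] : exists i, l = i + k by exists (l - k); lia.
case: k k0 L k1 il => [|[|k]] // _ L _ il.
have e0 : l - k.+2 = i by lia.
have e1 : l - k.+2.-1 = i.+1 by rewrite /=; lia.
have e2 : l - k.+2.-2 = i.+2 by rewrite /=; lia.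
rewrite e0 e1 e2 in L *.
split=> //; first exact: local_min_succ L.
have nl : ~~ less i.+1 i by case/and3P: L.
have [l1|l1] := boolP (less i.+2 i); first by constructor 1; apply: loss_le_right.
have k0 : 0 < k.
  case: k il {e0 e1 e2} => // il; move: l1; have -> : i.+2 = l by lia.
  by rewrite base //; lia.
case: (boolP (local_min i.+2)) => L'; [constructor 2|constructor 3]; split=> //.
- apply: (@loss_le_left N c fl i.+2) => //=; move: l1 L; rewrite /Pricing.local_min
  /Pricing.less; lia.
- move: l1 L; rewrite /Pricing.local_min /Pricing.less; lia.
- move: l1 L; rewrite /Pricing.local_min /Pricing.less; lia.
- move: nl L; rewrite /Pricing.local_min /Pricing.less; lia.
Qed.

End Loss.

Lemma big_nat_split3 (g : nat -> nat) l r N : l <= r < N ->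
  \sum_(0 <= i < N) g i =
  \sum_(0 <= i < l) g i + \sum_(l <= i < r.+1) g i + \sum_(r.+1 <= i < N) g i.
Proof.
case/andP=> lr rN; rewrite (big_cat_nat _ (n := r.+1)) //=.
by rewrite (big_cat_nat _ (n := l) (p := r.+1)) //=; lia.
Qed.

Lemma big_nat_block (g : nat -> nat) v N : v.+2 < N ->
  \sum_(0 <= i < N) g i = \sum_(0 <= i < v) g i
    + (g v + (g v.+1 + g v.+2)) + \sum_(v.+3 <= i < N) g i.
Proof.
move=> vN; rewrite (@big_nat_split3 _ v v.+2 N); last by rewrite leqW //= leqW.
have e : v.+3 - v = 3 by lia.
by rewrite [index_iota v _]/index_iota e /= !big_cons big_nil addn0.
Qed.

(** Three times [sum_pay]: the losses beside [g] are charged to all costs except [c g], and the loss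
    of [g] contributes at most [3 * c g], which leaves [2 * c g]. *)
Lemma pay_plain N c g : g < N -> (forall j, j < g -> c g < c j) ->
  (forall j, j < N -> c g <= c j) ->
  2 * \sum_(0 <= i < N) c i <= 3 * \sum_(0 <= i < N) pay N c pred0 i + 2 * c g.
Proof.
move=> gN lft mn; have := sum_pay N c pred0.
have hr : 3 * \sum_(g.+1 <= i < N) loss N c pred0 i <= \sum_(g.+1 <= i < N) c i.
  by apply: loss_right => j /andP[gj jN]; have := mn j jN; rewrite /less; lia.
have hl : 3 * \sum_(0 <= i < g) loss N c pred0 i <= \sum_(0 <= i < g) c i.
  by apply: loss_left => // j jg; have := lft j jg; rewrite /less; lia.
have : loss N c pred0 g <= c g.
  case: (boolP (local_min N c g)) => h; first exact: loss_le.
  by rewrite /loss (negbTE h).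
rewrite !(@big_nat_split3 _ g g N) ?leqnn // !big_nat1; lia.
Qed.

(** The three block edges lose nothing, so their cost [3 * m] is left uncharged. At [v] no trick is
    eligible, as neither far neighbour precedes it, and the long edge takes over; the other two have
    an equally cheap left neighbour and are not local minima. *)
Lemma pay_flat N c v m : v.+2 < N -> c v = m -> c v.+1 = m -> c v.+2 = m ->
  (forall j, j < v -> m < c j) -> (forall j, j < N -> m <= c j) ->
  2 * \sum_(0 <= i < N) c i + 3 * m <= 3 * \sum_(0 <= i < N) pay N c (pred1 v) i.
Proof.
move=> vN c0 c1 c2 lft mn; have := sum_pay N c (pred1 v).
have hr : 3 * \sum_(v.+3 <= i < N) loss N c (pred1 v) i <= \sum_(v.+3 <= i < N) c i.
  by apply: loss_right => j /andP[gj jN]; have := mn j jN; rewrite /less; lia.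
have hl : 3 * \sum_(0 <= i < v) loss N c (pred1 v) i <= \sum_(0 <= i < v) c i.
  by apply: loss_left => [|j jg]; first lia; have := lft j jg; rewrite /less; lia.
have nR : ~~ less N c v.+2 v by rewrite /less; lia.
have nL : ~~ less N c v.-2 v.
  by rewrite /less; case: (v) lft c0 => [|k] lft c0; [|have := lft k.-1]; rewrite /=; lia.
have l0 : loss N c (pred1 v) v = 0.
  by rewrite /loss /trick_left /trick_right /eligible_right /eligible_left (negbTE nL)
    (negbTE nR) /= !andbF eqxx if_same.
have l1 : loss N c (pred1 v) v.+1 = 0.
  by rewrite /loss /local_min [less N c v.+1.-1 _]/less /= c0 c1 eqxx; iflia.
have l2 : loss N c (pred1 v) v.+2 = 0.
  by rewrite /loss /local_min [less N c v.+2.-1 _]/less /= c2 c1 eqxx; iflia.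
have split g := big_nat_block g vN.
rewrite !split l0 l1 l2 c0 c1 c2.
clear -hl hr; lia.
Qed.

(** * Connectivity by tree edges of bounded price *)

Section Links.
Variables (N : nat) (c : nat -> nat) (fl : pred nat).
Local Notation less := (less N c).
Local Notation local_min := (local_min N c).
Local Notation trick_right := (trick_right N c).
Local Notation trick_left := (trick_left N c).
Local Notation te := (tree_edge N c fl).
Local Notation pidx := (price_idx N c).

Hypothesis flP : forall i, fl i ->
  [/\ i.+2 < N, c i.+1 = c i, c i.+2 = c i & forall j, j < N -> c i <= c j].

Lemma trick_right_spec i : trick_right i -> [/\ local_min i, less i.+2 i & c i <= c i.+1].
Proof.
by case/andP=> /and3P[h h1 h2] _; split=> //; move: h h1; rewrite /Pricing.local_min
  /Pricing.less; lia.
Qed.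

Lemma trick_left_spec i : trick_left i -> [/\ local_min i, 1 < i, less i.-2 i, ~~
  trick_right i & c i <= c i.-1].
Proof.
case/andP=> /and3P[h h1 h2] h3.
have i1 : 1 < i.
  by move: h h1; case: (i) => [|[|k]] //; rewrite /Pricing.local_min /Pricing.less /=; lia.
by split=> //; move: h h1; rewrite /Pricing.local_min /Pricing.less; lia.
Qed.

Lemma less_pred i : less i.-1 i -> 0 < i.
Proof. by case: i => //; rewrite /Pricing.less /=; lia. Qed.

Lemma price_idx_le i : c (pidx i) <= c i.
Proof.
rewrite /price_idx; case: ifP => // _; case: ifP => [/andP[i0]|_].
  by case: i i0 => // i _ /trick_right_spec[].
by case: ifP => // /trick_left_spec[].
Qed.

Lemma price_idx_lt i : i < N -> pidx i < N.
Proof.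
move=> iN; rewrite /price_idx; case: ifP => // _; case: ifP => [_|_]; first lia.
by case: ifP => // /trick_left_spec[/and3P[]].
Qed.

Lemma tree_edge_bound i : i < N -> (te i).1 < (te i).2 <= N.
Proof.
move=> iN; rewrite /tree_edge; case: ifP => h.
  case: ifP => [/trick_right_spec[_]|_]; first by rewrite /Pricing.less /=; lia.
  case: ifP => [/trick_left_spec[_ ? _ _ _]|_]; first by rewrite /=; lia.
  by case: ifP => [/flP[? _ _ _]|_] /=; lia.
case: ifP => l /=; first by move: l; rewrite /Pricing.less; lia.
by move: h; rewrite /Pricing.local_min iN l /= => /negbFE; rewrite /Pricing.less; lia.
Qed.

Lemma tree_edge_red i : keeps_red N c fl i -> te i = (i, i.+1).
Proof. by case/and4P; rewrite /tree_edge => -> /negbTE -> /negbTE -> /negbTE ->. Qed.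

Lemma tree_edge_blue i : i < N -> ~~ keeps_red N c fl i -> (te i).1.+1 < (te i).2.
Proof.
move=> iN; rewrite /tree_edge /keeps_red; case: ifP => h /=.
  case: ifP => //= hr; case: ifP => [/trick_left_spec[_ ? _ _ _] _|_] /=; first lia.
  by case: ifP.
by move=> _; case: ifP => //= /less_pred; lia.
Qed.

(** [G w a b] stands for being joined by tree edges of price at most [w]; only its closure
    properties matter, which keeps the argument on natural numbers. The induction follows the order
    [less]. For a right trick, [i] reaches [i.+2] by the tree edge of [i.+1], then [i.+3] by
    induction since edge [i.+2] precedes [i], then [i.+1] by the tree edge of [i]. *)
Lemma links_connect (G : nat -> nat -> nat -> Prop) :
  (forall w a b, G w a b -> G w b a) ->
  (forall w a b d, G w a b -> G w b d -> G w a d) ->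
  (forall w w' a b, w <= w' -> G w a b -> G w' a b) ->
  (forall i, i < N -> G (c (pidx i)) (te i).1 (te i).2) ->
  forall i, i < N -> G (c i) i i.+1.
Proof.
move=> Gs Gt Gm Ge i; move: {2}(c i) (erefl (c i)) => w.
elim/ltn_ind: w i => w IHw; elim/ltn_ind=> i IHi ci iN.
have IH j : less j i -> G (c i) j j.+1.
  case/andP=> jN /orP[h|/andP[/eqP h ji]].
    by apply: Gm (ltnW h) _; apply: IHw (erefl _) jN; rewrite -ci.
  by rewrite -h; apply: IHi => //; rewrite h.
have E j : j < N -> c (pidx j) <= c i -> G (c i) (te j).1 (te j).2.
  by move=> jN h; apply: Gm h _; apply: Ge.
have [L|nL] := boolP (local_min i); last first.
  have := E i iN (price_idx_le i); rewrite /tree_edge (negbTE nL); case: ifP => /= l.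
    have i0 := less_pred l.
    have := IH _ l; rewrite prednK // => h h'.
    by apply: Gt h'; apply: Gs.
  have l' : less i.+1 i by move: nL; rewrite /Pricing.local_min iN l /= negbK.
  by move=> h; apply: Gt h _; apply: Gs; apply: IH.
have pi : pidx i = i by rewrite /price_idx L.
have := E i iN; rewrite pi leqnn => /(_ isT).
have [R|nR] := boolP (trick_right i).
  have [_ l _] := trick_right_spec R.
  have iN1 : i.+1 < N by move: l; rewrite /Pricing.less; lia.
  have nL1 := local_min_succ L.
  have l1 : less i i.+1 by move: L; rewrite /Pricing.local_min /Pricing.less; lia.
  rewrite /tree_edge L R /= => h1; have := E i.+1 iN1.
  rewrite /price_idx (negbTE nL1) /= R leqnn /tree_edge (negbTE nL1) /= l1 => /(_ isT) h2.
  by rewrite /= in h2; apply: (Gt _ _ _ _ h2); apply: (Gt _ _ _ _ (IH _ l)); apply: Gs.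
have [T|nT] := boolP (trick_left i).
  have [_ i1 l _ _] := trick_left_spec T.
  have [k ik] : exists k, i = k.+2 by exists i.-2; lia.
  have l1 : less i.-2 i.-1 by move: L l; rewrite ik /Pricing.local_min /Pricing.less /=; lia.
  have nL1 : ~~ local_min i.-1 by apply: local_min_pred => //; lia.
  have nR1 : ~~ trick_right i.-2 by apply/negP => /trick_right_spec[_ + _]; move: l;
    rewrite ik /Pricing.less /=; lia.
  have i1N : i.-1 < N by lia.
  have i10 : 0 < i.-1 by lia.
  have e1 : i.-1.+1 = i by lia.
  have e2 : i.-2.+1 = i.-1 by lia.
  rewrite /tree_edge L (negbTE nR) T /= => h1; have := E i.-1 i1N.
  rewrite /price_idx (negbTE nL1) i10 /= (negbTE nR1) e1 T leqnn => /(_ isT).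
  rewrite /tree_edge (negbTE nL1) l1 /= e1 => h2.
  have := IH _ l; rewrite e2 /= in h2 * => h3.
  apply: (Gt _ _ _ _ _ h1); apply: (Gt _ _ _ _ _ h3); exact: Gs.
have [F|nF] := boolP (fl i); last first.
  by rewrite /tree_edge L (negbTE nR) (negbTE nT) (negbTE nF).
have [iN2 c1 c2 cm] := flP F.
rewrite /tree_edge L (negbTE nR) (negbTE nT) F /= => h1.
(* The edge [(i, i.+3)] is closed by [(i.+1, i.+3)], the tree edge of [i.+2], which has the same
   price because the block is flat. *)
have l2 : less i.+1 i.+2 by rewrite /Pricing.less c1 c2; lia.
have := E i.+2 iN2; rewrite /tree_edge.
have -> : local_min i.+2 = false by rewrite /Pricing.local_min /= l2 andbF.
have -> : c (pidx i.+2) <= c i by rewrite -c2 price_idx_le.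
rewrite l2 /= => /(_ isT) h2.
apply: (Gt _ _ _ _ h1); exact: Gs.
Qed.

End Links.

(** * A structured language for the machine *)

(** In contrast to [runs], no halt is demanded at the end, so that pieces of an execution can be
    concatenated. *)
Fixpoint stepn (P : seq instr) (k : nat) (c : config) : option config :=
  if k is k'.+1 then if step P c is Some c1 then stepn P k' c1 else None
  else Some c.

Lemma stepn_add P j k c d : stepn P j c = Some d ->
  stepn P (j + k) c = stepn P k d.
Proof.
elim: j c => [c [->] //|j IH c] /=.
by case: (step P c) => // c1 /IH.
Qed.

Definition reach P (T : nat) c d := exists2 k, k <= T & stepn P k c = Some d.

Lemma reach0 P c : reach P 0 c c. Proof. by exists 0. Qed.

Lemma reach_trans P T U c d e : reach P T c d -> reach P U d e -> reach P (T + U) c e.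
Proof.
move=> [j jT hj] [k kU hk]; exists (j + k); first exact: leq_add.
by rewrite (stepn_add _ hj).
Qed.

Lemma reach_le P T U c d : T <= U -> reach P T c d -> reach P U c d.
Proof. by move=> TU [k kT h]; exists k => //; exact: leq_trans TU. Qed.

Lemma reach_step P T c c1 d : step P c = Some c1 -> reach P T c1 d -> reach P T.+1 c d.
Proof. by move=> h [k kT hk]; exists k.+1; rewrite //= h. Qed.

Lemma reach_halt P T c d : reach P T c d -> step P d = None -> halts_within P c T d.
Proof.
case=> k kT hk hd; exists k => //; elim: k c {kT} hk => /= [c [->]|k IH c].
  by rewrite hd.
by case: (step P c) => // c1 /IH.
Qed.

Definition code_at (P : seq instr) (off : nat) (q : seq instr) :=
  exists P1 P2, P = P1 ++ q ++ P2 /\ size P1 = off.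

Lemma code_at_cat P off q1 q2 : code_at P off (q1 ++ q2) ->
  code_at P off q1 /\ code_at P (off + size q1) q2.
Proof.
case=> P1 [P2 [-> <-]]; split; first by exists P1, (q2 ++ P2); rewrite -!catA.
by exists (P1 ++ q1), P2; rewrite size_cat -!catA.
Qed.

Lemma code_at_cons P off i q : code_at P off (i :: q) ->
  nth IHalt P off = i /\ code_at P off.+1 q.
Proof.
move=> h; have [[P1 [P2 [PE <-]]] h2] := code_at_cat (q1 := [:: i]) h.
split; first by rewrite PE nth_cat ltnn subnn.
by move: h2; rewrite addn1.
Qed.

Inductive expr := Var of nat | Lit of nat | Plus of expr & expr
  | Minus of expr & expr | Get of nat & expr | Cond of expr & expr & expr.

Inductive com := Asg of nat & expr | Put of nat & expr & expr | Seq of com & com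
  | If of expr & com & com | While of expr & com.

Record state := State { var : nat -> nat; heap : nat -> nat -> nat }.

Fixpoint ev s e := match e with
  | Var r => var s r
  | Lit k => k
  | Plus a b => ev s a + ev s b
  | Minus a b => ev s a - ev s b
  | Get f a => heap s f (ev s a)
  | Cond a b d => if ev s a == 0 then ev s d else ev s b
  end.

Definition set_var s r v :=
  State (fun x => if x == r then v else var s x) (heap s).
Definition set_heap s f i v :=
  State (var s) (fun g j => if (g == f) && (j == i) then v else heap s g j).

(* Variables live in registers 1..23, temporaries in 24..63; register 0 holds
   the base [B >= 64] of the heap, whose field [f] of record [i] has address
   [B + 8 i + f]. *)
Definition agree B (m : nat -> nat) s :=
  [/\ m 0 = B, forall r, 0 < r < 24 -> m r = var s r
    & forall f i, f < 8 -> m (B + 8 * i + f) = heap s f i].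

(** Three doublings stand for the multiplication by the record width eight; register 0 adds the
    base. *)
Definition address t f := [:: IAdd t t t; IAdd t t t; IAdd t t t; IAdd t t 0;
  IConst t.+1 f; IAdd t t t.+1].

Fixpoint esize e := match e with
  | Var _ => 2 | Lit _ => 1
  | Plus a b | Minus a b => esize a + esize b + 1
  | Get _ a => esize a + 7
  | Cond a b d => esize a + (esize b + esize d + 2)
  end.

Fixpoint ecode t off e := match e with
  | Var r => [:: IConst t 0; IAdd t t r]
  | Lit k => [:: IConst t k]
  | Plus a b => ecode t off a ++ ecode t.+1 (off + esize a) b ++ [:: IAdd t t t.+1]
  | Minus a b => ecode t off a ++ ecode t.+1 (off + esize a) b ++ [:: ISub t t t.+1]
  | Get f a => ecode t off a ++ address t f ++ [:: ILoad t t]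
  | Cond a b d =>
      let ob := (off + esize a).+1 in let od := (ob + esize b).+1 in
      ecode t off a ++ IJz t od :: ecode t ob b ++ IJmp (od + esize d) :: ecode t od d
  end.

(** Temporaries are used as a stack; [t < 63] also leaves room for the scratch register [t.+1] of
    [address]. *)
Fixpoint ewf t e := match e with
  | Var r => 0 < r < 24
  | Lit _ => true
  | Plus a b | Minus a b => ewf t a && ewf t.+1 b
  | Get f a => (f < 8) && ewf t a
  | Cond a b d => [&& ewf t a, ewf t b & ewf t d]
  end && (t < 63).

Lemma size_ecode t off e : size (ecode t off e) = esize e.
Proof.
elim: e t off => //= [a IHa b IHb|a IHa b IHb|f a IHa|a IHa b IHb d IHd] t off;
  rewrite !size_cat /= ?size_cat /= ?IHa ?IHb ?IHd; lia.
Qed.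

Lemma reach_address P t f off m q : code_at P off (address t f ++ q) -> 24 <= t ->
  exists m', [/\ reach P 6 (Config off m) (Config (off + 6) m'),
    m' t = m 0 + 8 * m t + f & forall x, x != t -> x != t.+1 -> m' x = m x].
Proof.
move=> /code_at_cons[h1] /code_at_cons[h2] /code_at_cons[h3] /code_at_cons[h4].
move=> /code_at_cons[h5] /code_at_cons[h6] _ t24.
eexists; split.
- do 6! (apply: reach_step; first by rewrite /step /= ?h1 ?h2 ?h3 ?h4 ?h5 ?h6).
  by rewrite !addnS addn0; exact: reach0.
- have e1 : (t == t.+1) = false by lia.
  have e2 : (0 == t) = false by lia.
  by rewrite /upd /= !(eqxx, e1, e2); lia.
- by move=> x /negbTE xt /negbTE xt1; rewrite /upd xt xt1.
Qed.

Lemma agree_frame B m m' s : agree B m s -> 64 <= B ->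
  (forall x, x < 24 \/ 64 <= x -> m' x = m x) -> agree B m' s.
Proof.
case=> h1 h2 h3 B64 fr; split=> [|r h|f i f8].
- by rewrite fr //; left.
- by rewrite fr ?h2 //; left; lia.
- by rewrite fr ?h3 //; right; lia.
Qed.

Lemma ecode_correct P B s e t off m : ewf t e -> 24 <= t -> 64 <= B ->
  code_at P off (ecode t off e) -> agree B m s ->
  exists m', [/\ reach P (esize e) (Config off m) (Config (off + esize e) m'),
    m' t = ev s e & forall x, x < t \/ 64 <= x -> m' x = m x].
Proof.
move=> wf t24 B64; elim: e t off m wf t24 => /=.
- move=> r t off m /andP[r24 t63] t24 /code_at_cons[h1] /code_at_cons[h2 _] [_ hv _].
  eexists; split.
  + do 2! (apply: reach_step; first by rewrite /step /= ?h1 ?h2).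
    by rewrite addn2; exact: reach0.
  + rewrite /upd /= eqxx; have -> : (r == t) = false by lia.
    by rewrite hv.
  + by move=> x xt; rewrite /upd; have -> : (x == t) = false by lia.
- move=> k t off m t63 t24 /code_at_cons[h1 _] ag; eexists; split.
  + apply: reach_step; first by rewrite /step /= h1.
    by rewrite addn1; exact: reach0.
  + by rewrite /upd eqxx.
  + by move=> x xt; rewrite /upd; have -> : (x == t) = false by lia.
- move=> a IHa b IHb t off m /andP[/andP[wa wb] t63] t24.
  move=> /code_at_cat[ha]; rewrite size_ecode => /code_at_cat[hb].
  rewrite size_ecode => /code_at_cons[h1 _] ag.
  have [m1 [r1 v1 f1]] := IHa t off m wa t24 ha ag.
  have ag1 : agree B m1 s by apply: agree_frame ag B64 _ => x xt; apply: f1; lia.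
  have [m2 [r2 v2 f2]] := IHb t.+1 _ m1 wb (leqW t24) hb ag1.
  exists (upd m2 t (ev s a + ev s b)); split.
  + have -> : off + (esize a + esize b + 1) = (off + esize a + esize b).+1 by lia.
    apply: reach_trans (reach_trans r1 r2) _; apply: reach_step; last exact: reach0.
    by rewrite /step h1 /= v2 f2 ?v1 ?addnA //; lia.
  + by rewrite /upd eqxx.
  + move=> x xt; rewrite /upd; have -> : (x == t) = false by lia.
    by rewrite f2 ?f1 //; lia.
- move=> a IHa b IHb t off m /andP[/andP[wa wb] t63] t24.
  move=> /code_at_cat[ha]; rewrite size_ecode => /code_at_cat[hb].
  rewrite size_ecode => /code_at_cons[h1 _] ag.
  have [m1 [r1 v1 f1]] := IHa t off m wa t24 ha ag.
  have ag1 : agree B m1 s by apply: agree_frame ag B64 _ => x xt; apply: f1; lia.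
  have [m2 [r2 v2 f2]] := IHb t.+1 _ m1 wb (leqW t24) hb ag1.
  exists (upd m2 t (ev s a - ev s b)); split.
  + have -> : off + (esize a + esize b + 1) = (off + esize a + esize b).+1 by lia.
    apply: reach_trans (reach_trans r1 r2) _; apply: reach_step; last exact: reach0.
    by rewrite /step h1 /= v2 f2 ?v1 ?addnA //; lia.
  + by rewrite /upd eqxx.
  + move=> x xt; rewrite /upd; have -> : (x == t) = false by lia.
    by rewrite f2 ?f1 //; lia.
- move=> f a IHa t off m /andP[/andP[f8 wa] t63] t24.
  move=> /code_at_cat[ha]; rewrite size_ecode => hb ag.
  have [m1 [r1 v1 f1]] := IHa t off m wa t24 ha ag.
  have ag1 : agree B m1 s by apply: agree_frame ag B64 _ => x xt; apply: f1; lia.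
  have [m2 [r2 v2 f2]] := reach_address m1 hb t24.
  have [_] := code_at_cat (q1 := address t f) hb; rewrite /= => /code_at_cons[h1 _].
  have [m1B _ m1h] := ag1; rewrite m1B v1 in v2.
  have m2h : m2 (B + 8 * ev s a + f) = heap s f (ev s a).
    by rewrite f2 ?m1h //; lia.
  exists (upd m2 t (heap s f (ev s a))); split.
  + have -> : off + (esize a + 7) = (off + esize a + 6).+1 by lia.
    rewrite -[7]/(6 + 1) addnA; apply: reach_trans (reach_trans r1 r2) _.
    apply: reach_step; last exact: reach0.
    by rewrite /step h1 /= v2 m2h.
  + by rewrite /upd eqxx.
  + move=> x xt; rewrite /upd; have -> : (x == t) = false by lia.
    by rewrite f2 ?f1 //; lia.
- move=> a IHa b IHb d IHd t off m /andP[/and3P[wa wb wd] t63] t24.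
  move=> /code_at_cat[ha]; rewrite size_ecode => /code_at_cons[h1].
  rewrite -addSn => /code_at_cat[hb]; rewrite size_ecode => /code_at_cons[h2 hd] ag.
  have [m1 [r1 v1 f1]] := IHa t off m wa t24 ha ag.
  have ag1 : agree B m1 s by apply: agree_frame ag B64 _ => x xt; apply: f1; lia.
  case: ifP => e0.
    have [m2 [r2 v2 f2]] := IHd t _ m1 wd t24 hd ag1.
    exists m2; split=> //; last by move=> x xt; rewrite f2 ?f1.
    have -> : off + (esize a + (esize b + esize d + 2))
      = ((off + esize a).+1 + esize b).+1 + esize d by lia.
    apply: reach_trans r1 _; apply: reach_le (reach_step _ r2); first lia.
    by rewrite /step h1 /= v1 e0.
  have [m2 [r2 v2 f2]] := IHb t _ m1 wb t24 hb ag1.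
  exists m2; split=> //; last by move=> x xt; rewrite f2 ?f1.
  have -> : off + (esize a + (esize b + esize d + 2))
      = ((off + esize a).+1 + esize b).+1 + esize d by lia.
  apply: reach_trans r1 _; apply: (@reach_le _ (esize b + 1).+1); first lia.
  apply: (@reach_step _ _ _ (Config (off + esize a).+1 m1)).
    by rewrite /step h1 /= v1 e0.
  apply: reach_trans r2 _; apply: reach_step; last exact: reach0.
  by rewrite /step h2.
Qed.

Fixpoint csize c := match c with
  | Asg _ e => esize e + 2
  | Put _ a b => esize b + (esize a + 7)
  | Seq c d => csize c + csize d
  | If e c d => esize e + (csize c + csize d + 2)
  | While e c => esize e + (csize c + 2)
  end.

Fixpoint ccode off c := match c with
  | Asg r e => ecode 24 off e ++ [:: IConst r 0; IAdd r r 24]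
  | Put f a b => ecode 24 off b ++ ecode 25 (off + esize b) a ++
      address 25 f ++ [:: IStore 25 24]
  | Seq c d => ccode off c ++ ccode (off + csize c) d
  | If e c d =>
      let oc := (off + esize e).+1 in let od := (oc + csize c).+1 in
      ecode 24 off e ++ IJz 24 od :: ccode oc c ++ IJmp (od + csize d) :: ccode od d
  | While e c =>
      let oc := (off + esize e).+1 in
      ecode 24 off e ++ IJz 24 (oc + csize c).+1 :: ccode oc c ++ [:: IJmp off]
  end.

Fixpoint cwf c := match c with
  | Asg r e => (0 < r < 24) && ewf 24 e
  | Put f a b => [&& f < 8, ewf 25 a & ewf 24 b]
  | Seq c d => cwf c && cwf d
  | If e c d => [&& ewf 24 e, cwf c & cwf d]
  | While e c => ewf 24 e && cwf c
  end.

Lemma size_ccode off c : size (ccode off c) = csize c.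
Proof.
elim: c off => //= [r e|f a b|c IHc d IHd|e c IHc d IHd|e c IHc] off;
  rewrite !size_cat /= ?size_cat /= ?size_ecode ?IHc ?IHd; lia.
Qed.

(** A total-correctness triple with a time bound, quantified over the surrounding program and the
    offset so that compiled pieces compose. *)
Definition exec c s T (Q : state -> Prop) := forall P off m B,
  cwf c -> code_at P off (ccode off c) -> 64 <= B -> agree B m s ->
  exists m' s', [/\ reach P T (Config off m) (Config (off + csize c) m'),
    agree B m' s' & Q s'].

Lemma exec_weak c s T T' (Q Q' : state -> Prop) : T <= T' ->
  (forall s', Q s' -> Q' s') -> exec c s T Q -> exec c s T' Q'.
Proof.
move=> TT QQ ex P off m B wf hc B64 ag.
have [m' [s' [h1 h2 h3]]] := ex P off m B wf hc B64 ag.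
by exists m', s'; split; [exact: reach_le h1| |exact: QQ].
Qed.

Lemma exec_asg r e s (Q : state -> Prop) :
  Q (set_var s r (ev s e)) -> exec (Asg r e) s (esize e + 2) Q.
Proof.
move=> q P off m B /andP[r24 we] /code_at_cat[ha]; rewrite size_ecode.
move=> /code_at_cons[h1 /code_at_cons[h2 _]] B64 ag.
have [m1 [r1 v1 f1]] := ecode_correct we (leqnn 24) B64 ha ag.
have [g1 g2 g3] : agree B m1 s by apply: agree_frame ag B64 _ => x; exact: f1.
eexists; exists (set_var s r (ev s e)); split=> //.
  have -> : off + (esize e + 2) = (off + esize e).+2 by lia.
  apply: reach_trans r1 _.
  apply: reach_step; first by rewrite /step /= h1.
  apply: reach_step; last exact: reach0.
  by rewrite /step /= h2.
have e24 : (24 == r) = false by lia.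
split=> [|x x24|f i f8]; rewrite /upd /=.
- by have -> : (0 == r) = false by lia.
- rewrite eqxx e24 v1 add0n; case: eqP => // _; exact: g2.
- have -> : (B + 8 * i + f == r) = false by lia.
  by rewrite g3.
Qed.

Lemma agree_put B m s f i v : f < 8 -> 64 <= B -> agree B m s ->
  agree B (upd m (B + 8 * i + f) v) (set_heap s f i v).
Proof.
move=> f8 B64 [g1 g2 g3]; split=> [|x x24|g j g8]; rewrite /upd /=.
- by have -> : (0 == B + 8 * i + f) = false by lia.
- have -> : (x == B + 8 * i + f) = false by lia.
  by rewrite g2.
have -> : (B + 8 * j + g == B + 8 * i + f) = (g == f) && (j == i).
  by apply/eqP/andP => [h|[/eqP -> /eqP ->] //]; split; lia.
by case: ifP => // _; rewrite g3.
Qed.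

Lemma exec_put f a b s (Q : state -> Prop) :
  Q (set_heap s f (ev s a) (ev s b)) -> exec (Put f a b) s (esize b + (esize a + 7)) Q.
Proof.
move=> q P off m B /and3P[f8 wa wb] /= /code_at_cat[hb]; rewrite size_ecode.
move=> /code_at_cat[ha]; rewrite size_ecode => hc B64 ag.
have [m1 [r1 v1 f1]] := ecode_correct wb (leqnn 24) B64 hb ag.
have ag1 : agree B m1 s by apply: agree_frame ag B64 _ => x; exact: f1.
have [m2 [r2 v2 f2]] := ecode_correct wa (leqW (leqnn 24)) B64 ha ag1.
have ag2 : agree B m2 s by apply: agree_frame ag1 B64 _ => x xt; apply: f2; lia.
have [m3 [r3 v3 f3]] := reach_address m2 hc (leqW (leqnn 24)).
have ag3 : agree B m3 s by apply: agree_frame ag2 B64 _ => x xt; apply: f3; lia.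
have [_] := code_at_cat (q1 := address 25 f) hc; rewrite /= => /code_at_cons[h1 _].
have [m2B _ _] := ag2; rewrite m2B v2 in v3.
exists (upd m3 (m3 25) (m3 24)), (set_heap s f (ev s a) (ev s b)); split=> //.
  have -> : off + (esize b + (esize a + 7)) = (off + esize b + esize a + 6).+1 by lia.
  apply: reach_trans r1 _; rewrite -[7]/(6 + 1).
  apply: reach_trans r2 _; apply: reach_trans r3 _.
  apply: reach_step; last exact: reach0.
  by rewrite /step h1.
have -> : m3 24 = ev s b by rewrite f3 // f2 ?v1 //; lia.
by rewrite v3; apply: agree_put.
Qed.

Lemma exec_seq c d s T U (Q1 Q : state -> Prop) : exec c s T Q1 ->
  (forall s', Q1 s' -> exec d s' U Q) -> exec (Seq c d) s (T + U) Q.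
Proof.
move=> ec ed P off m B /andP[wc wd] /code_at_cat[hc]; rewrite size_ccode => hd B64 ag.
have [m1 [s1 [r1 ag1 q1]]] := ec P off m B wc hc B64 ag.
have [m2 [s2 [r2 ag2 q2]]] := ed s1 q1 P _ m1 B wd hd B64 ag1.
by exists m2, s2; split=> //=; rewrite addnA; apply: reach_trans r1 r2.
Qed.

Lemma exec_if e c d s T (Q : state -> Prop) :
  (ev s e != 0 -> exec c s T Q) -> (ev s e = 0 -> exec d s T Q) ->
  exec (If e c d) s (esize e + (T + 2)) Q.
Proof.
move=> ec ed P off m B /and3P[we wc wd] /= /code_at_cat[he]; rewrite size_ecode.
move=> /code_at_cons[h1]; rewrite -addSn => /code_at_cat[hc].
rewrite size_ccode => /code_at_cons[h2 hd] B64 ag.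
have [m1 [r1 v1 f1]] := ecode_correct we (leqnn 24) B64 he ag.
have ag1 : agree B m1 s by apply: agree_frame ag B64 _ => x; exact: f1.
have -> : off + (esize e + (csize c + csize d + 2))
    = ((off + esize e).+1 + csize c).+1 + csize d by lia.
have [e0|e0] := eqVneq (ev s e) 0.
  have [m2 [s2 [r2 ag2 q2]]] := ed e0 P _ m1 B wd hd B64 ag1.
  exists m2, s2; split=> //.
  apply: reach_trans r1 _; apply: reach_le (reach_step _ r2); first lia.
  by rewrite /step h1 /= v1 e0.
have [m2 [s2 [r2 ag2 q2]]] := ec e0 P _ m1 B wc hc B64 ag1.
exists m2, s2; split=> //.
apply: reach_trans r1 _; apply: (@reach_le _ (T + 1).+1); first lia.
apply: (@reach_step _ _ _ (Config (off + esize e).+1 m1)).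
  by rewrite /step h1 /= v1 (negbTE e0).
apply: reach_trans r2 _; apply: reach_step; last exact: reach0.
by rewrite /step h2.
Qed.

(** The index of the invariant bounds the iterations still to come; that it is positive whenever the
    guard holds gives termination. *)
Lemma exec_while e c s T k (I : nat -> state -> Prop) (Q : state -> Prop) :
  (forall j s', I j s' -> ev s' e != 0 -> 0 < j /\ exec c s' T (I j.-1)) ->
  (forall j s', I j s' -> ev s' e = 0 -> Q s') -> I k s ->
  exec (While e c) s (k * (esize e + T + 2) + (esize e + 1)) Q.
Proof.
move=> body fin ik P off m B /andP[we wc] /= hw B64 ag.
have := hw; move=> /code_at_cat[he]; rewrite size_ecode.
move=> /code_at_cons[h1]; rewrite -addSn => /code_at_cat[hc].
rewrite size_ccode => /code_at_cons[h2 _].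
have -> : off + (esize e + (csize c + 2)) = ((off + esize e).+1 + csize c).+1 by lia.
elim: k s m ik ag => [|k IH] s m ik ag.
all: have [m1 [r1 v1 f1]] := ecode_correct we (leqnn 24) B64 he ag.
all: have ag1 : agree B m1 s by apply: agree_frame ag B64 _ => x; exact: f1.
all: have [e0|e0] := eqVneq (ev s e) 0.
- exists m1, s; split=> //; last exact: fin ik e0.
  rewrite mul0n add0n; apply: reach_trans r1 _; apply: reach_step; last exact: reach0.
  by rewrite /step h1 /= v1 e0.
- by have [] := body _ _ ik e0.
- exists m1, s; split=> //; last exact: fin ik e0.
  apply: (@reach_le _ (esize e + 1)); first lia.
  apply: reach_trans r1 _; apply: reach_step; last exact: reach0.
  by rewrite /step h1 /= v1 e0.
have [_ ec] := body _ _ ik e0.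
have [m2 [s2 [r2 ag2 q2]]] := ec P _ m1 B wc hc B64 ag1.
have [m3 [s3 [r3 ag3 q3]]] := IH s2 m2 q2 ag2.
exists m3, s3; split=> //; rewrite mulSn -addnA.
apply: (@reach_le _ (esize e + (T + (k * (esize e + T + 2) + (esize e + 1)).+1).+1)).
  by lia.
apply: reach_trans r1 _.
apply: (@reach_step _ _ _ (Config (off + esize e).+1 m1)).
  by rewrite /step h1 /= v1 (negbTE e0).
apply: reach_trans r2 _; apply: reach_step r3.
by rewrite /step h2.
Qed.

Lemma exec_asg_seq r e d s T (Q : state -> Prop) :
  exec d (set_var s r (ev s e)) T Q -> exec (Seq (Asg r e) d) s (esize e + 2 + T) Q.
Proof.
move=> h; apply: (exec_seq (Q1 := eq (set_var s r (ev s e)))) => [|_ <-] //.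
exact: exec_asg.
Qed.

Lemma exec_put_seq f a b d s T (Q : state -> Prop) :
  exec d (set_heap s f (ev s a) (ev s b)) T Q ->
  exec (Seq (Put f a b) d) s (esize b + (esize a + 7) + T) Q.
Proof.
move=> h; apply: (exec_seq (Q1 := eq (set_heap s f (ev s a) (ev s b)))) => [|_ <-] //.
exact: exec_put.
Qed.

Lemma exec_le c s T T' (Q : state -> Prop) : T <= T' ->
  exec c s T Q -> exec c s T' Q.
Proof. by move=> TT; apply: exec_weak. Qed.

(** Any nonzero value counts as true: truncated subtraction then serves as a comparison and addition
    as a disjunction. *)
Definition truth s e := ev s e != 0.
Definition Not e := Minus (Lit 1) e.
Definition And a b := Cond a b (Lit 0).
Definition Or a b := Plus a b.
Definition Lt a b := Minus b a.
Definition Le a b := Minus (Plus b (Lit 1)) a.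
Definition Eq a b := Not (Plus (Minus a b) (Minus b a)).

Lemma truth_not s e : truth s (Not e) = ~~ truth s e.
Proof. by rewrite /truth /Not /=; case: (ev s e). Qed.

Lemma truth_and s a b : truth s (And a b) = truth s a && truth s b.
Proof. by rewrite /truth /And /=; case: (ev s a). Qed.

Lemma truth_or s a b : truth s (Or a b) = truth s a || truth s b.
Proof. by rewrite /truth /Or /= addn_eq0 negb_and. Qed.

Lemma truth_lt s a b : truth s (Lt a b) = (ev s a < ev s b).
Proof. by rewrite /truth /Lt /= -lt0n subn_gt0. Qed.

Lemma truth_le s a b : truth s (Le a b) = (ev s a <= ev s b).
Proof. by rewrite /truth /Le /= -lt0n subn_gt0 addn1. Qed.

Lemma truth_eq s a b : truth s (Eq a b) = (ev s a == ev s b).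
Proof. by rewrite /Eq truth_not /truth /= negbK addn_eq0 !subn_eq0 -eqn_leq. Qed.

Lemma ev_cond s a b d : ev s (Cond a b d) = if truth s a then ev s b else ev s d.
Proof. by rewrite /truth /=; case: (ev s a). Qed.

Definition Skip := Asg 14 (Lit 0).

(* Variable 5 is multiplied by variable 6, by repeated doubling. *)
Definition mult :=
  Seq (Asg 14 (Var 5)) (Seq (Asg 5 (Lit 0))
  (While (Var 6)
    (Seq (Asg 7 (Lit 1)) (Seq (Asg 8 (Var 14))
    (Seq (While (Le (Plus (Var 7) (Var 7)) (Var 6))
           (Seq (Asg 7 (Plus (Var 7) (Var 7))) (Asg 8 (Plus (Var 8) (Var 8)))))
    (Seq (Asg 6 (Minus (Var 6) (Var 7))) (Asg 5 (Plus (Var 5) (Var 8))))))))).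

Definition same_vars (l : seq nat) s s' := forall y, y \notin l -> var s' y = var s y.
Definition same_fields (l : seq nat) s s' :=
  forall f, f \notin l -> forall i, heap s' f i = heap s f i.

Lemma same_vars_set l s s' r v : r \in l -> same_vars l s s' ->
  same_vars l s (set_var s' r v).
Proof. by move=> rl h y yl /=; case: eqP => [e|_]; [rewrite e rl in yl|exact: h]. Qed.

Lemma same_fields_set l s s' f i v : f \in l -> same_fields l s s' ->
  same_fields l s (set_heap s' f i v).
Proof.
by move=> fl h g gl j /=; case: eqP => [e|_] /=; [rewrite e fl in gl|exact: h].
Qed.

(** Without a shift to the right, the leading bit of the multiplier has to be found by doubling from
    1. Each outer round removes that bit, hence at most [K] rounds of at most [K] doublings. *)
Lemma exec_mult s K : var s 6 < 2 ^ K ->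
  exec mult s (40 * K.+1 ^ 2) (fun s' => [/\ var s' 5 = var s 5 * var s 6,
    same_vars [:: 5; 6; 7; 8; 14] s s' & same_fields [::] s s']).
Proof.
move=> yK; set x := var s 5; set y := var s 6.
pose J j s' := [/\ var s' 5 + var s' 6 * x = x * y, var s' 14 = x, var s' 6 < 2 ^ j,
  same_vars [:: 5; 6; 7; 8; 14] s s' & same_fields [::] s s'].
eapply exec_le; last first.
- apply: exec_asg_seq; apply: exec_asg_seq.
  apply: (exec_while (I := fun j s' => j <= K /\ J j s') (k := K)).
  + move=> j s' [jK [e1 e2 e3 e4 e5]] /= nz.
    have j0 : 0 < j by move: e3; case: (j) => //=; lia.
    split=> //; apply: exec_asg_seq; apply: exec_asg_seq.
    set s1 := set_var _ _ _.
    pose I k t := [/\ var t 8 = var t 7 * x, 0 < var t 7 <= var t 6, var t 6 < var t 7 * 2 ^ k,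
      [/\ var t 5 = var s' 5, var t 6 = var s' 6 & var t 14 = x] &
      same_vars [:: 5; 6; 7; 8; 14] s t /\ same_fields [::] s t].
    apply: (exec_seq (Q1 := fun t => exists k, I k t /\ var t 6 < var t 7 + var t 7)).
      apply: (exec_while (I := I) (k := K)).
      * move=> k t [h1 h2 h3 [h4 h5 h6] [h7 h8]] le.
        have {}le : var t 7 + var t 7 <= var t 6 by move: le => /=; lia.
        have k0 : 0 < k by move: h3; case: (k) => //; rewrite expn0; lia.
        split=> //; apply: exec_asg_seq; apply: exec_asg.
        rewrite /I /=; split=> //; try lia.
        -- by move: h3; rewrite -{1}(prednK k0) expnS; lia.
        -- by split=> //; do !apply: same_vars_set.
      * move=> k t hI /= le; exists k; split=> //; lia.
      * rewrite /I /s1 /=; split=> //; rewrite ?mul1n //; try lia.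
          by apply: leq_trans e3 _; rewrite leq_exp2l.
        by split=> //; do !apply: same_vars_set.
    move=> t [k [[h1 h2 h3 [h4 h5 h6] [h7 h8]] le]].
    apply: exec_asg_seq; apply: exec_asg; split; first by lia.
    rewrite /J /=; split=> //.
    * move: e1; rewrite h1 h4 h5; nia.
    * by move: e3; rewrite -{1}(prednK j0) expnS h5; lia.
    * by do !apply: same_vars_set.
  + move=> j s' [_ [e1 e2 e3 e4 e5]] /= z; split=> //.
    by move: e1; rewrite z mul0n addn0.
  + split=> //; rewrite /J /=; split=> //; first by rewrite mulnC.
    by do !apply: same_vars_set.
by rewrite /=; nia.
Qed.

(** * The algorithm *)

Lemma exec_ite e c d s T (Q : state -> Prop) :
  (truth s e -> exec c s T Q) -> (~~ truth s e -> exec d s T Q) ->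
  exec (If e c d) s (esize e + (T + 2)) Q.
Proof.
move=> h1 h2; apply: exec_if => [|e0]; first exact: h1.
by apply: h2; rewrite /truth e0.
Qed.

Definition For x body := While (Lt (Var x) (Var 2)) body.

Lemma exec_for x body s N i0 T (J : nat -> state -> Prop) :
  (forall i s', J i s' -> var s' x = i /\ var s' 2 = N) ->
  (forall i s', i0 <= i < N -> J i s' -> exec body s' T (J i.+1)) -> J i0 s ->
  exec (For x body) s ((N - i0) * (T + 7) + 6) (J (maxn i0 N)).
Proof.
move=> Jv Jb J0.
pose I k s' := exists i, [/\ i0 <= i, i <= maxn i0 N, k = N - i & J i s'].
have -> : (N - i0) * (T + 7) + 6 = (N - i0) * (5 + T + 2) + (5 + 1) by congr (_ * _ + _); lia.
apply: (exec_while (I := I) (k := N - i0)); last by exists i0; split; rewrite ?leq_maxl.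
- move=> k s' [i [i0i iN kE Ji]] t; have [vi vN] := Jv _ _ Ji.
  have iN' : i < N by have := truth_lt s' (Var x) (Var 2); rewrite /truth t /= vi vN.
  split; first by lia.
  apply: exec_weak (leqnn T) _ (Jb i s' _ Ji); last by rewrite i0i.
  by move=> s2 J2; exists i.+1; split=> //; lia.
- move=> k s' [i [i0i iN kE Ji]] t; have [vi vN] := Jv _ _ Ji.
  have iN' : ~~ (i < N) by have := truth_lt s' (Var x) (Var 2); rewrite /truth t /= vi vN
    => <-.
  by have -> : maxn i0 N = i by lia.
Qed.

(* Variable 2 holds the number of red edges, 3 and 4 are loop counters, 9 is the
   cheapest edge, 10 and 11 are the flag and the start of the flattened block, 13
   is the length of the output.  Heap field 0 holds the input words, 1 the integer
   costs, 7 the output words. *)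
Definition scale :=
  Seq (Asg 3 (Lit 0)) (For 3
   (Seq (Asg 5 (Get 0 (Plus (Plus (Var 3) (Var 3)) (Lit 1))))
   (Seq (Asg 4 (Lit 0))
   (Seq (For 4
      (Seq (If (Eq (Var 3) (Var 4)) Skip
             (Seq (Asg 6 (Get 0 (Plus (Plus (Var 4) (Var 4)) (Lit 2)))) mult))
           (Asg 4 (Plus (Var 4) (Lit 1)))))
   (Seq (Put 1 (Var 3) (Var 5)) (Asg 3 (Plus (Var 3) (Lit 1)))))))).

(** The cost of edge [i] times the product of all denominators. After the vertex count in word 0,
    edge [j] occupies the words [2 j + 1] and [2 j + 2]. *)
Definition scaled (h : nat -> nat) N i :=
  h (i + i + 1) * \prod_(0 <= j < N | j != i) h (j + j + 2).

(** The time of [mult] depends only on the multiplier in variable 6, here always an input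
    denominator; the growing product sits in variable 5. A bound on the denominators is therefore
    enough. *)
Lemma exec_scale s N K : var s 2 = N ->
  (forall j, j < N -> heap s 0 (j + j + 2) < 2 ^ K) ->
  exec scale s (400 * N.+1 ^ 2 * K.+1 ^ 2) (fun s' =>
    [/\ forall i, i < N -> heap s' 1 i = scaled (heap s 0) N i,
      same_vars [:: 3; 4; 5; 6; 7; 8; 14] s s' & same_fields [:: 1] s s']).
Proof.
move=> vN small; set l := [:: 3; 4; 5; 6; 7; 8; 14].
have same2 s' : same_vars l s s' -> var s' 2 = N by move=> h; rewrite h.
have same0 s' : same_fields [:: 1] s s' -> heap s' 0 =1 heap s 0 by move=> h; apply: h.
eapply exec_le; last first.
- apply: exec_asg_seq.
  pose J i s' := [/\ var s' 3 = i, forall k, k < i -> heap s' 1 k = scaled (heap s 0) N k,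
    same_vars l s s' & same_fields [:: 1] s s'].
  apply: (@exec_weak _ _ _ _ (J (maxn 0 N)) _ (leqnn _)).
    by rewrite max0n => s' [_ h1 h2 h3]; split.
  apply: (exec_for (J := J)).
  + by move=> i s' [-> _ /same2 -> _].
  + move=> i s' /= iN [e1 e2 e3 e4].
    apply: exec_asg_seq; apply: exec_asg_seq.
    pose I k t := [/\ var t 4 = k,
      var t 5 = heap s 0 (i + i + 1) * \prod_(0 <= j < k | j != i) heap s 0 (j + j + 2),
      var t 3 = i, heap t 1 =1 heap s' 1 & same_vars l s t /\ same_fields [:: 1] s t].
    apply: (exec_seq (Q1 := I N)).
      rewrite -{2}(max0n N); apply: (exec_for (J := I)).
      * by move=> k t [-> _ _ _ [/same2 -> _]].
      * move=> k t /= kN [h1 h2 h3 h4 [h5 h6]].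
        apply: (exec_seq (Q1 := fun t => [/\ var t 4 = k,
            var t 5 = heap s 0 (i + i + 1) * \prod_(0 <= j < k.+1 | j != i) heap s 0 (j + j
              + 2),
            var t 3 = i, heap t 1 =1 heap s' 1 & same_vars l s t /\ same_fields [:: 1] s t])).
          apply: (@exec_ite _ _ _ _ (16 + 40 * K.+1 ^ 2)); rewrite truth_eq /= h1 h3.
            move=> /eqP ik; apply: (@exec_le _ _ 3); first lia.
            apply: exec_asg; rewrite /= h1 h3; split=> //.
              by rewrite h2 big_mkcond [in RHS]big_mkcond big_nat_recr //= ik eqxx muln1.
            by split=> //; apply: same_vars_set.
          move=> ik; apply: exec_asg_seq.
          have b := same0 _ h6 (k + k + 2).
          apply: exec_weak (leqnn _) _ (exec_mult (K := K) _).
            move=> u [g1 g2 g3]; rewrite /= !h1 in g1; split.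
            -- by rewrite g2 //= h1.
            -- rewrite g1 h2 b -mulnA; congr (_ * _).
               rewrite big_mkcond [in RHS]big_mkcond big_nat_recr //= eq_sym ik //.
            -- by rewrite g2 //= h3.
            -- by move=> z; rewrite (g3 1) //= h4.
            -- split=> [z zl|f fl z]; last by rewrite (g3 f) //= h6.
               by rewrite g2 /=; [case: eqP => [e|_]; [move: zl; rewrite e | exact: h5]
                 | move: zl; rewrite !inE; lia].
          by rewrite /= h1 b; apply: small; lia.
        move=> u [g1 g2 g3 g4 [g5 g6]]; apply: exec_asg; rewrite /I /= g1 addn1; split=> //.
        by split=> //; apply: same_vars_set.
      * rewrite /I /= e1; split=> //.
        -- by rewrite big_geq // muln1 (same0 _ e4).
        -- by split=> //; do !apply: same_vars_set.
    move=> t [h1 h2 h3 h4 [h5 h6]]; apply: exec_put_seq; apply: exec_asg.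
    rewrite /J /= h3 addn1; split=> //; last first.
    * by apply: same_fields_set.
    * by apply: same_vars_set.
    move=> k ki; case: eqP => [->|ne]; first by rewrite h2.
    by rewrite h4 e2 //; lia.
  + rewrite /J /=; split=> //.
    by apply: same_vars_set.
rewrite /=; nia.
Qed.

Definition Inc x k := Asg x (Plus (Var x) (Lit k)).

Definition find_min :=
  Seq (Asg 9 (Lit 0)) (Seq (Asg 3 (Lit 1)) (For 3
    (Seq (If (Lt (Get 1 (Var 3)) (Get 1 (Var 9))) (Asg 9 (Var 3)) Skip) (Inc 3 1)))).

Lemma exec_find_min s N : var s 2 = N ->
  exec find_min s (100 * N.+1) (fun s' =>
    [/\ 0 < N -> leftmost_min N (heap s 1) (var s' 9),
      same_vars [:: 3; 9; 14] s s' & same_fields [::] s s']).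
Proof.
move=> vN; set l := [:: 3; 9; 14]; set c := heap s 1.
pose J i s' := [/\ var s' 3 = i, leftmost_min i c (var s' 9), same_vars l s s'
  & same_fields [::] s s'].
eapply exec_le; last first.
- apply: exec_asg_seq; apply: exec_asg_seq.
  apply: (@exec_weak _ _ _ _ (J (maxn 1 N)) _ (leqnn _)).
    move=> s' [_ h1 h2 h3]; split=> // N0.
    by have <- : maxn 1 N = N by lia.
  apply: (exec_for (J := J)).
  + by move=> i s' [-> _ h _]; rewrite h.
  + move=> i s' /andP[i1 iN] [e1 [gi lft mn] e3 e4].
    apply: (exec_seq (Q1 := fun t => [/\ var t 3 = i, leftmost_min i.+1 c (var t 9),
        same_vars l s t & same_fields [::] s t])).
      apply: (@exec_ite _ _ _ _ 4); rewrite truth_lt /= !(e4 1) // e1 -/c => h.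
        apply: exec_asg; rewrite /= e1; split=> //; last by apply: same_vars_set.
        split=> // j; first by move=> ji; have := mn j ji; lia.
        by rewrite ltnS leq_eqVlt => /orP[/eqP -> //|/mn]; lia.
      apply: (@exec_le _ _ 3) => //; apply: exec_asg; rewrite /= e1; split=> //.
        split=> //; first by lia.
        by move=> j; rewrite ltnS leq_eqVlt => /orP[/eqP ->|/mn //]; lia.
      by apply: same_vars_set.
    move=> t [g1 g2 g3 g4]; apply: exec_asg; rewrite /J /= g1 addn1; split=> //.
    by apply: same_vars_set.
  + rewrite /J /=; split=> //; first by split=> // j; case: j.
    by do !apply: same_vars_set.
rewrite /=; lia.
Qed.

Definition BlockSum x := Plus (Get 1 (Var x))
  (Plus (Get 1 (Plus (Var x) (Lit 1))) (Get 1 (Plus (Var x) (Lit 2)))).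
Definition Double e := Plus e e.

(** Variable 12 is a strict upper threshold for twice a block sum. It starts at [11 * c g + 1], as
    [8 + 2 + 1] copies of [c g] plus one, and afterwards holds twice the best sum so far. *)
Definition choose_block :=
  Seq (Asg 10 (Lit 0)) (Seq (Asg 11 (Lit 0)) (Seq (Asg 14 (Get 1 (Var 9)))
  (Seq (Asg 12 (Plus (Double (Double (Double (Var 14))))
    (Plus (Double (Var 14)) (Plus (Var 14) (Lit 1)))))
  (Seq (Asg 3 (Lit 0)) (For 3
    (Seq (If (And (And (Le (Var 9) (Plus (Var 3) (Lit 2)))
                       (And (Le (Var 3) (Var 9)) (Lt (Plus (Var 3) (Lit 2)) (Var 2))))
                  (Lt (Double (BlockSum 3)) (Var 12)))
            (Seq (Asg 12 (Double (BlockSum 3)))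
            (Seq (Asg 11 (Var 3)) (Asg 10 (Lit 1))))
            Skip)
         (Inc 3 1))))))).

Lemma exec_choose_block s N : var s 2 = N ->
  exec choose_block s (300 * N.+1) (fun s' =>
    [/\ block_choice N (heap s 1) (var s 9) (var s' 10 != 0) (var s' 11),
      same_vars [:: 3; 10; 11; 12; 14] s s' & same_fields [::] s s']).
Proof.
move=> vN; set l := [:: 3; 10; 11; 12; 14]; set c := heap s 1; set g := var s 9.
pose K i s' := (var s' 10 = 0 /\ var s' 12 = 11 * c g + 1 /\
    forall u, u < i -> block_ok N g u -> 11 * c g < 2 * block_sum c u) \/
  (var s' 10 = 1 /\ [/\ block_ok N g (var s' 11), var s' 12 = 2 * block_sum c (var s' 11),
     2 * block_sum c (var s' 11) <= 11 * c g &
     forall u, u < i -> block_ok N g u -> block_sum c (var s' 11) <= block_sum c u]).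
pose J i s' := [/\ var s' 3 = i, K i s', same_vars l s s' & same_fields [::] s s'].
have okN u : block_ok N g u -> u < N by case/and3P; lia.
eapply exec_le; last first.
- do 5!apply: exec_asg_seq.
  apply: (@exec_weak _ _ _ _ (J (maxn 0 N)) _ (leqnn _)).
    rewrite max0n => s' [_ h1 h2 h3]; split=> //.
    case: h1 => [[-> [_ h]]|[-> [h4 h5 h6 h7]]]; rewrite /block_choice /=.
      by move=> u ok; apply: h => //; apply: okN.
    by split=> // u ok; apply: h7 => //; apply: okN.
  apply: (exec_for (J := J)).
  + by move=> i s' [-> _ h _]; rewrite h.
  + move=> i s' /= iN [e1 e2 e3 e4].
    apply: (exec_seq (Q1 := fun t => [/\ var t 3 = i, K i.+1 t, same_vars l s t
       & same_fields [::] s t])).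
      have v9 : var s' 9 = g by rewrite e3.
      have v2 : var s' 2 = N by rewrite e3.
      have bs : ev s' (Double (BlockSum 3)) = 2 * block_sum c i.
        by rewrite /= !(e4 1) // e1 addn1 addn2 -/c /block_sum; lia.
      apply: (@exec_ite _ _ _ _ 100).
        rewrite !truth_and !truth_le !truth_lt bs; rewrite /= v9 v2 e1 addn2.
        move=> /andP[ok lt]; eapply exec_le; last first.
          apply: exec_asg_seq; apply: exec_asg_seq; apply: exec_asg; rewrite bs /= e1.
          split=> //; last by do !apply: same_vars_set.
          right => /=; split=> //; case: e2 => [[_ [h1 h2]]|[_ [h1 h2 h3 h4]]].
            split=> //; first by lia.
            move=> u; rewrite ltnS leq_eqVlt => /orP[/eqP -> //|ui] ok'.
            by have := h2 u ui ok'; lia.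
          split=> //; first by lia.
          move=> u; rewrite ltnS leq_eqVlt => /orP[/eqP -> //|ui] ok'.
          by have := h4 u ui ok'; lia.
        by [].
      rewrite !truth_and !truth_le !truth_lt bs; rewrite /= v9 v2 e1 addn2 => nok.
      apply: (@exec_le _ _ 3) => //; apply: exec_asg; rewrite /= e1; split=> //.
        case: e2 => [[h0 [h1 h2]]|[h0 [h1 h2 h3 h4]]]; [left|right]; split=> //.
          split=> // u; rewrite ltnS leq_eqVlt => /orP[/eqP ->|ui] ok'; last exact: h2.
          by move: nok ok'; rewrite /block_ok h1; lia.
        split=> // u; rewrite ltnS leq_eqVlt => /orP[/eqP ->|ui] ok'; last exact: h4.
        by move: nok ok'; rewrite /block_ok h2 /=; lia.
      by apply: same_vars_set.
    move=> t [g1 g2 g3 g4]; apply: exec_asg; rewrite /J /= g1 addn1; split=> //.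
    by apply: same_vars_set.
  + rewrite /J /= -/g -/c; split=> //; last by do !apply: same_vars_set.
    by left; split=> //; split=> //=; lia.
rewrite /=; lia.
Qed.

(** * Machine expressions for the pricing rules *)

Definition Suc e k := Plus e (Lit k).
Definition Pred e k := Minus e (Lit k).
Definition BlockRepE e := Cond (And (Var 10) (And (Le (Var 11) e) (Le e (Suc (Var 11) 2))))
  (Var 9) e.
Definition CostE e := Get 1 (BlockRepE e).
Definition LessE j i := And (Lt j (Var 2))
  (Or (Lt (CostE j) (CostE i)) (And (Eq (CostE j) (CostE i)) (Lt j i))).
Definition LocalMinE i := And (Lt i (Var 2))
  (And (Not (LessE (Pred i 1) i)) (Not (LessE (Suc i 1) i))).
Definition EligibleRightE i := And (LocalMinE i) (And (LessE (Suc i 2) i)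
  (Lt (CostE (Suc i 1)) (Double (CostE i)))).
Definition EligibleLeftE i := And (LocalMinE i) (And (LessE (Pred i 2) i)
  (Lt (CostE (Pred i 1)) (Double (CostE i)))).
Definition TrickRightE i := And (EligibleRightE i)
  (Or (Not (EligibleLeftE i)) (Le (CostE (Suc i 1)) (CostE (Pred i 1)))).
Definition TrickLeftE i := And (EligibleLeftE i) (Not (TrickRightE i)).
Definition FlE i := And (Var 10) (Eq i (Var 11)).
Definition KeepE i := And (LocalMinE i) (And (Not (TrickRightE i)) (And (Not (TrickLeftE
  i)) (Not (FlE i)))).
Definition PriceE i := Cond (LocalMinE i) i
  (Cond (And (Lt (Lit 0) i) (TrickRightE (Pred i 1))) (Pred i 1)
    (Cond (TrickLeftE (Suc i 1)) (Suc i 1) i)).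
Definition Edge1E i := Cond (LocalMinE i) (Cond (TrickRightE i) (Suc i 1) (Cond (TrickLeftE
  i) (Pred i 1) i))
  (Cond (LessE (Pred i 1) i) (Pred i 1) i).
Definition Edge2E i :=
  Cond (LocalMinE i)
    (Cond (TrickRightE i) (Suc i 3) (Cond (TrickLeftE i) (Suc i 1) (Cond (FlE i) (Suc i 3)
      (Suc i 1))))
    (Cond (LessE (Pred i 1) i) (Suc i 1) (Suc i 2)).

Section Rules.
Variable s : state.
Let N := var s 2.
Let g := var s 9.
Let fl := var s 10 != 0.
Let v := var s 11.
Let c := flat_cost (heap s 1) g fl v.

Lemma ev_suc e k : ev s (Suc e k) = ev s e + k. Proof. by []. Qed.

Lemma ev_pred e k : ev s (Pred e k) = ev s e - k. Proof. by []. Qed.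

Lemma ev_double e : ev s (Double e) = ev s e + ev s e. Proof. by []. Qed.

Lemma ev_block_rep e : ev s (BlockRepE e) = block_rep fl v g (ev s e).
Proof. by rewrite /BlockRepE ev_cond !truth_and !truth_le ev_suc /block_rep /in_block /=
  addn2. Qed.

Lemma ev_costE e : ev s (CostE e) = c (ev s e).
Proof. by rewrite /c /flat_cost -ev_block_rep. Qed.

Lemma truth_less j i : truth s (LessE j i) = less N c (ev s j) (ev s i).
Proof.
by rewrite /LessE truth_and truth_or truth_and truth_eq !truth_lt !ev_costE.
Qed.

Lemma truth_local_min i : truth s (LocalMinE i) = local_min N c (ev s i).
Proof.
by rewrite /LocalMinE !truth_and !truth_not !truth_less truth_lt ev_suc ev_pred subn1 addn1.
Qed.

Lemma truth_eligible_right i : truth s (EligibleRightE i) = eligible_right N c (ev s i).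
Proof.
rewrite /EligibleRightE truth_and truth_local_min truth_and truth_less truth_lt ev_double
  !ev_costE !ev_suc.
by rewrite addn1 addn2.
Qed.

Lemma truth_eligible_left i : truth s (EligibleLeftE i) = eligible_left N c (ev s i).
Proof.
rewrite /EligibleLeftE truth_and truth_local_min truth_and truth_less truth_lt ev_double
  !ev_costE !ev_pred.
by rewrite subn1 subn2.
Qed.

Lemma truth_trick_right i : truth s (TrickRightE i) = trick_right N c (ev s i).
Proof.
rewrite /TrickRightE truth_and truth_eligible_right truth_or truth_not truth_eligible_left
  truth_le !ev_costE.
by rewrite ev_pred ev_suc addn1 subn1.
Qed.

Lemma truth_trick_left i : truth s (TrickLeftE i) = trick_left N c (ev s i).
Proof. by rewrite /TrickLeftE truth_and truth_eligible_left truth_not truth_trick_right. Qed.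

Lemma truth_fl i : truth s (FlE i) = flat_at fl v (ev s i).
Proof. by rewrite /FlE truth_and truth_eq. Qed.

Lemma truth_keep i : truth s (KeepE i) = keeps_red N c (flat_at fl v) (ev s i).
Proof.
rewrite /KeepE truth_and truth_local_min truth_and truth_not truth_trick_right.
by rewrite truth_and truth_not truth_trick_left truth_not truth_fl.
Qed.

Lemma ev_price i : ev s (PriceE i) = price_idx N c (ev s i).
Proof.
rewrite /PriceE ev_cond truth_local_min ev_cond truth_and truth_lt truth_trick_right
  ev_cond truth_trick_left.
by rewrite ev_suc ev_pred addn1 subn1.
Qed.

Lemma ev_edge1 i : ev s (Edge1E i) = (tree_edge N c (flat_at fl v) (ev s i)).1.
Proof.
rewrite /Edge1E ev_cond truth_local_min !(ev_cond _ (TrickRightE _)) truth_trick_right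
  (ev_cond _ (TrickLeftE _)) truth_trick_left ev_cond truth_less.
rewrite ev_suc ev_pred addn1 subn1 /tree_edge; do 4!case: ifP => //.
Qed.

Lemma ev_edge2 i : ev s (Edge2E i) = (tree_edge N c (flat_at fl v) (ev s i)).2.
Proof.
rewrite /Edge2E ev_cond truth_local_min (ev_cond _ (TrickRightE _)) truth_trick_right
  (ev_cond _ (TrickLeftE _)) truth_trick_left.
rewrite (ev_cond _ (FlE _)) truth_fl (ev_cond _ (LessE _ _)) truth_less.
rewrite !ev_suc ev_pred addn1 subn1 addn2 addn3 /tree_edge; do 4!case: ifP => //.
Qed.

End Rules.

(** The price is copied as the numerator and denominator words of the edge whose cost it is, with
    block edges redirected to [g]. *)
Definition out_words :=
    (Seq (Asg 14 (BlockRepE (PriceE (Var 3))))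
    (Seq (Put 7 (Var 13) (Edge1E (Var 3)))
    (Seq (Put 7 (Suc (Var 13) 1) (Edge2E (Var 3)))
    (Seq (Put 7 (Suc (Var 13) 2) (Get 0 (Suc (Double (Var 14)) 1)))
    (Seq (Put 7 (Suc (Var 13) 3) (Get 0 (Suc (Double (Var 14)) 2)))
         (Inc 13 4)))))).

Definition out_body := If (KeepE (Var 3)) Skip out_words.

Definition write_out := Seq (Asg 13 (Lit 0)) (Seq (Asg 3 (Lit 0))
  (For 3 (Seq out_body (Inc 3 1)))).

Definition out_prefix N c fl (pq : nat -> nat * nat) k :=
  encode_solution [seq (tree_edge N c fl i, pq i) | i <- iota 0 k & ~~ keeps_red N c fl i].

Lemma out_prefixS N c fl pq k : out_prefix N c fl pq k.+1 = out_prefix N c fl pq k ++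
  if keeps_red N c fl k then [::]
  else [:: (tree_edge N c fl k).1; (tree_edge N c fl k).2; (pq k).1; (pq k).2].
Proof.
rewrite /out_prefix /encode_solution -addn1 iotaD filter_cat !map_cat flatten_cat /=.
by rewrite add0n; case: (keeps_red N c fl k).
Qed.

Lemma exec_write_out s N :
  let g := var s 9 in let fl := var s 10 != 0 in let v := var s 11 in
  let c := flat_cost (heap s 1) g fl v in
  let pq i := let x := block_rep fl v g (price_idx N c i) in
    (heap s 0 (x + x + 1), heap s 0 (x + x + 2)) in
  let out := out_prefix N c (flat_at fl v) pq N in
  var s 2 = N ->
  exec write_out s (N * (csize out_body + 20) + 20) (fun s' =>
    var s' 13 = size out /\ forall j, j < size out -> heap s' 7 j = nth 0 out j).
Proof.
move=> g fl v c pq out vN; set l := [:: 3; 13; 14].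
pose o k := out_prefix N c (flat_at fl v) pq k.
pose W k s' := [/\ var s' 13 = size (o k), forall j, j < size (o k) -> heap s' 7 j = nth 0
  (o k) j,
  same_vars l s s' & same_fields [:: 7] s s'].
pose J k s' := var s' 3 = k /\ W k s'.
eapply exec_le; last first.
- do 2!apply: exec_asg_seq.
  apply: (@exec_weak _ _ _ _ (J (maxn 0 N)) _ (leqnn _)).
    by rewrite max0n => s' [_ [h1 h2 _ _]].
  apply: (exec_for (J := J)).
  + by move=> i s' [-> [_ _ h _]]; rewrite h.
  + move=> i s' /= iN [e1 [e2 e3 e4 e5]].
    apply: (exec_seq (T := csize out_body) (Q1 := fun t => var t 3 = i /\ W i.+1 t)).
      pose ctx t := [/\ var t 2 = N, var t 3 = i, heap t 1 = heap s 1 &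
        [/\ var t 9 = var s 9, var t 10 = var s 10 & var t 11 = var s 11]].
      have kE t : ctx t -> truth t (KeepE (Var 3)) = keeps_red N c (flat_at fl v) i.
        by case=> h2 h3 h1 [h9 h10 h11]; rewrite truth_keep h2 h1 h9 h10 h11 /= h3.
      have pE t : ctx t -> ev t (BlockRepE (PriceE (Var 3))) = block_rep fl v g (price_idx
        N c i).
        by case=> h2 h3 h1 [h9 h10 h11]; rewrite ev_block_rep ev_price h2 h1 h9 h10 h11 /= h3.
      have t1E t : ctx t -> ev t (Edge1E (Var 3)) = (tree_edge N c (flat_at fl v) i).1.
        by case=> h2 h3 h1 [h9 h10 h11]; rewrite ev_edge1 h2 h1 h9 h10 h11 /= h3.
      have t2E t : ctx t -> ev t (Edge2E (Var 3)) = (tree_edge N c (flat_at fl v) i).2.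
        by case=> h2 h3 h1 [h9 h10 h11]; rewrite ev_edge2 h2 h1 h9 h10 h11 /= h3.
      have cs' : ctx s'.
        split; [by rewrite e4|by []| |by rewrite !e4].
        by apply: functional_extensionality => z; exact: e5.
      have h0 z : heap s' 0 z = heap s 0 z by exact: e5.
      apply: (@exec_le _ _ (esize (KeepE (Var 3)) + (csize out_words + 2))).
        have -> : csize out_body = esize (KeepE (Var 3)) + (csize Skip + csize out_words +
          2) by [].
        by lia.
      apply: exec_ite; rewrite kE // => kr.
        apply: (@exec_le _ _ (csize Skip)); first by [].
        apply: exec_asg; split=> //; rewrite /W /o out_prefixS kr cats0; split=> //.
        by apply: same_vars_set.
      eapply exec_le; last first.
        apply: exec_asg_seq; rewrite pE //; set x := block_rep _ _ _ _; set s1 := set_var _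
          _ _.
        have cs1 : ctx s1 by case: cs' => h2 h3 h1 [h9 h10 h11].
        apply: exec_put_seq; rewrite t1E //; set t1 := (tree_edge _ _ _ _).1; set s2 :=
          set_heap _ _ _ _.
        have cs2 : ctx s2 by case: cs1 => h2 h3 h1 [h9 h10 h11].
        apply: exec_put_seq; rewrite t2E //; set t2 := (tree_edge _ _ _ _).2; set s3 :=
          set_heap _ _ _ _.
        apply: exec_put_seq; apply: exec_put_seq; apply: exec_asg.
        rewrite /= e1 e2 !h0; split=> //; split.
        * by rewrite /o out_prefixS (negbTE kr) size_cat.
        * move=> j; rewrite /o out_prefixS (negbTE kr) size_cat nth_cat /= -/(o i) ?e2 => jl.
          have [ji|ij] := ltnP j (size (o i)).
            have -> : (j == size (o i) + 3) = false by lia.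
            have -> : (j == size (o i) + 2) = false by lia.
            have -> : (j == size (o i) + 1) = false by lia.
            have -> : (j == size (o i)) = false by lia.
            exact: e3.
          have [k jE] : exists k, j = size (o i) + k by exists (j - size (o i)); lia.
          have : k < 4 by lia.
          have eqk b : (size (o i) + k == size (o i) + b) = (k == b) by lia.
          have eqk0 : (size (o i) + k == size (o i)) = (k == 0) by lia.
          rewrite jE addKn !eqk eqk0.
          by case: k {jE eqk eqk0} => [|[|[|[|k]]]].
        * by do !apply: same_vars_set.
        * by do !apply: same_fields_set.
      by [].
    move=> t [e1' [g2 g3 g4 g5]]; apply: exec_asg; rewrite /J /= e1' addn1; split=> //.
    by split=> //; apply: same_vars_set.
  + split=> //; split=> //.
    by do !apply: same_vars_set.
- move: (csize out_body) => T; rewrite /=; nia.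
Qed.

(** * Moving input and output *)

Definition straight i := match i with IJz _ _ | IJmp _ | IHalt => false | _ => true end.

Definition effect (m : nat -> nat) i := match i with
  | IConst r k => upd m r k
  | IAdd r a b => upd m r (m a + m b)
  | ISub r a b => upd m r (m a - m b)
  | ILoad r a => upd m r (m (m a))
  | IStore a b => upd m (m a) (m b)
  | _ => m
  end.

Lemma reach_straight P off q m : all straight q -> code_at P off q ->
  reach P (size q) (Config off m) (Config (off + size q) (foldl effect m q)).
Proof.
elim: q off m => [|i q IH] off m /=; first by rewrite addn0 => _ _; exact: reach0.
case/andP=> si sq /code_at_cons[hi hq]; rewrite addnS -addSn.
by apply: reach_step (IH _ _ sq hq); rewrite /step hi; case: i si {hi}.
Qed.

Definition doubling := nseq 6 (IAdd 0 0 0).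
Definition save_cells k :=
  flatten [seq [:: IAdd 0 0 1; IStore 0 j.+1] | j <- iota 1 k].
Definition save_low := [:: IStore 0 1; IConst 1 8] ++ save_cells 5 ++ [:: IAdd 0 0 1].
(** Cell 0 has become the write pointer, so the length of the input is no longer at hand. It is
    recovered from the vertex count, the first saved word: [2 n - 1] words minus the six already
    saved leaves [2 n - 7]. *)
Definition load_setup := [:: IConst 4 48; ISub 6 0 4; ILoad 3 6; IAdd 3 3 3;
  IConst 4 7; ISub 3 3 4; IConst 2 7; IConst 5 1].
Definition load_body := [:: ILoad 4 2; IStore 0 4; IAdd 0 0 1; IAdd 2 2 5; ISub 3 3 5].
Definition load_end := [:: IConst 4 0; IAdd 0 6 4].
(* Registers are freed by moving the input to addresses [64 s + 8 j]: the only
   initially known pointer is the length [s] of the input in cell 0. *)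
Definition prelude := doubling ++ save_low ++ load_setup ++
  IJz 3 34 :: load_body ++ IJmp 27 :: load_end.

Lemma save_cells_correct B m k : 64 <= B -> k < 60 -> m 0 = B -> m 1 = 8 ->
  let m' := foldl effect m (save_cells k) in
  [/\ m' 0 = B + 8 * k, forall x, 0 < x < B + 8 -> m' x = m x
    & forall j, 0 < j <= k -> m' (B + 8 * j) = m j.+1].
Proof.
move=> B64 + m0 m1; elim: k => [|k IH] k60.
  by split=> [|//|j]; [rewrite muln0 addn0 | lia].
have [h0 h1 h2] := IH (ltnW k60).
have -> : save_cells k.+1 = save_cells k ++ [:: IAdd 0 0 1; IStore 0 k.+2].
  by rewrite /save_cells -[k.+1]addn1 iotaD map_cat flatten_cat /= add1n addn1.
rewrite foldl_cat; set m' := foldl effect m _ in h0 h1 h2 *.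
have m'1 : m' 1 = 8 by rewrite h1 //; lia.
have m'k : m' k.+2 = m k.+2 by apply: h1; lia.
rewrite /= /upd /= h0 m'1 m'k; split.
- have -> : (0 == B + 8 * k + 8) = false by lia.
  by lia.
- move=> x xB; have -> : (x == B + 8 * k + 8) = false by lia.
  have -> : (x == 0) = false by lia.
  by rewrite h1.
move=> j jk; case: eqP => [e|ne].
  by have -> : j = k.+1 by lia.
have -> : (B + 8 * j == 0) = false by lia.
by apply: h2; lia.
Qed.

Lemma doubling_correct m : let m' := foldl effect m doubling in
  m' 0 = 64 * m 0 /\ forall x, 0 < x -> m' x = m x.
Proof. by split=> [|[]] //; rewrite /= /upd /=; lia. Qed.

Lemma save_low_correct m B : 64 <= B -> m 0 = B ->
  let m' := foldl effect m save_low in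
  [/\ m' 0 = B + 48, m' 1 = 8, forall x, 6 < x < B -> m' x = m x
    & forall j, j < 6 -> m' (B + 8 * j) = m j.+1].
Proof.
move=> B64 m0; rewrite /save_low 2!foldl_cat.
have mE x : foldl effect m [:: IStore 0 1; IConst 1 8] x =
    if x == 1 then 8 else if x == B then m 1 else m x by rewrite /= /upd m0.
move: (foldl effect m [:: IStore 0 1; IConst 1 8]) mE => m1 mE.
have b0 : m1 0 = B by rewrite mE /= m0; case: eqP => // e; lia.
have b1 : m1 1 = 8 by rewrite mE.
have [c0 c1 c2] := save_cells_correct B64 (isT : 5 < 60) b0 b1.
move: (foldl effect m1 (save_cells 5)) c0 c1 c2 => m2 c0 c1 c2.
have m'E x : foldl effect m2 [:: IAdd 0 0 1] x = if x == 0 then B + 48 else m2 x.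
  rewrite /= /upd c0 c1 ?b1; last by lia.
  by case: eqP => // _; lia.
move: (foldl effect m2 [:: IAdd 0 0 1]) m'E => m' m'E.
split.
- by rewrite m'E.
- by rewrite m'E /= c1 //; clear -B64; lia.
- move=> x xB; rewrite m'E; have -> : (x == 0) = false by clear -xB; lia.
  rewrite c1; last by clear -xB; lia.
  rewrite mE; have -> : (x == 1) = false by clear -xB; lia.
  by have -> : (x == B) = false by [clear -xB; lia].
- move=> j j6; rewrite m'E; have -> : (B + 8 * j == 0) = false by clear -B64; lia.
  have [->|j0] := posnP j.
    rewrite muln0 addn0 c1; last by clear -B64; lia.
    by rewrite mE eqxx; have -> : (B == 1) = false by [clear -B64; lia].
  rewrite c2; last by clear -j6 j0; lia.
  rewrite mE; have -> : (j.+1 == 1) = false by clear -j0; lia.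
  by have -> : (j.+1 == B) = false by [clear -j6 B64; lia].
Qed.

Lemma load_setup_correct m B n : m 0 = B + 48 -> m B = n -> 64 <= B ->
  let m' := foldl effect m load_setup in
  [/\ m' 0 = B + 48, m' 2 = 7, m' 3 = n + n - 7, [/\ m' 1 = m 1, m' 5 = 1 & m' 6 = B]
    & forall x, 6 < x -> m' x = m x].
Proof.
move=> m0 mB B64 m'.
have e : m 0 - 48 = B by rewrite m0 addnK.
have m'E x : m' x = if x == 5 then 1 else if x == 2 then 7 else
    if x == 3 then m (m 0 - 48) + m (m 0 - 48) - 7 else if x == 4 then 7 else
    if x == 6 then m 0 - 48 else m x.
  rewrite /m' /= /upd /=.
  have -> : (m 0 - 48 == 6) = false by rewrite e; clear -B64; lia.
  have -> : (m 0 - 48 == 4) = false by rewrite e; clear -B64; lia.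
  by case: (x == 5); case: (x == 2); case: (x == 3); case: (x == 4).
split; rewrite ?m'E ?e ?mB //=.
move=> x x6; rewrite m'E.
have -> : (x == 5) = false by clear -x6; lia.
have -> : (x == 2) = false by clear -x6; lia.
have -> : (x == 3) = false by clear -x6; lia.
have -> : (x == 4) = false by clear -x6; lia.
by have -> : (x == 6) = false by [clear -x6; lia].
Qed.

Lemma load_body_correct m v : m 1 = 8 -> m 5 = 1 -> 7 <= m 0 -> m (m 2) = v ->
  let m' := foldl effect m load_body in
  forall x, m' x = if x == 3 then m 3 - 1 else if x == 2 then m 2 + 1 else
      if x == 0 then m 0 + 8 else if x == m 0 then v else if x == 4 then v else m x.
Proof.
move=> m1 m5 m07 mv m' x; rewrite /m' /= /upd /= mv.
have -> : (0 == m 0) = false by lia.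
have -> : (2 == m 0) = false by lia.
have -> : (3 == m 0) = false by lia.
have -> : (1 == m 0) = false by lia.
have -> : (5 == m 0) = false by lia.
by rewrite m1 m5.
Qed.

(** The base [64 * S] exceeds every input address, so copies never overwrite words still to be read.
    The second alternative on [S] covers inputs of at most six words, for which the copying loop is
    empty. *)
Lemma prelude_correct P m0 S n : code_at P 0 prelude -> m0 0 = S -> m0 1 = n ->
  0 < S -> S = (n + n - 7) + 6 \/ S <= 6 /\ n + n <= 7 ->
  exists m, [/\ reach P (7 * S + 100) (Config 0 m0) (Config 36 m), m 0 = 64 * S
    & forall j, j < S -> m (64 * S + 8 * j) = m0 j.+1].
Proof.
move=> code mS mn S0 Sn.
have [h1 code1] := code_at_cat code.
have [h2 code2] := code_at_cat code1.
have [h3 code3] := code_at_cat code2.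
have [h4 code4] := code_at_cons code3.
have [h5 code5] := code_at_cat (q1 := load_body) code4.
have [h6 h7] := code_at_cons code5.
rewrite /= in h2 h3 h4 h5 h6 h7.
have r1 := reach_straight m0 (isT : all straight doubling) h1.
have [a0 a1] := doubling_correct m0; rewrite mS in a0.
move: (foldl effect m0 doubling) r1 a0 a1 => m1 r1 a0 a1.
move: a0; set B := 64 * S => a0.
have B64 : 64 <= B by rewrite /B; lia.
have SB : S < B by rewrite /B; lia.
have r2 := reach_straight m1 (isT : all straight save_low) h2.
have [d0 d1 d2 d3] := save_low_correct B64 a0.
move: (foldl effect m1 save_low) r2 d0 d1 d2 d3 => m4 r2 d0 d1 d2 d3.
have r3 := reach_straight m4 (isT : all straight load_setup) h3.
have dn : m4 B = n by have := d3 0 isT; rewrite muln0 addn0 a1 // mn.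
have [e0 e2 e3 [e1 e5 e6] e7] := load_setup_correct d0 dn B64.
move: (foldl effect m4 load_setup) r3 e0 e2 e3 e1 e5 e6 e7 => m5 r3 e0 e2 e3 e1 e5 e6 e7.
pose I j m := [/\ m 0 = B + 8 * (6 + j), m 2 = 7 + j, m 3 = n + n - 7 - j,
  [/\ m 1 = 8, m 5 = 1 & m 6 = B] & [/\ forall x, 6 < x < B -> m x = m0 x
    & forall i, i < 6 + j -> m (B + 8 * i) = m0 i.+1]].
have I0 : I 0 m5.
  split=> //; first by rewrite e3 subn0.
    by rewrite e1.
  split=> [x xB|i i6].
    rewrite e7; last by clear -xB; lia.
    by rewrite d2 // a1 //; clear -xB; lia.
  rewrite e7; last by clear -B64; lia.
  by rewrite d3 ?a1.
have loop k j m : k = n + n - 7 - j -> j <= n + n - 7 -> I j m ->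
    exists m', reach P (7 * k + 1) (Config 27 m) (Config 34 m') /\ I (n + n - 7) m'.
  elim: k j m => [|k IH] j m kE jle Ij.
    have [i0 i2 i3 _ _] := Ij; exists m; split; last by have <- : j = n + n - 7 by lia.
    by apply: reach_step (reach0 _ _); rewrite /step h4 /= i3 -kE.
  have [i0 i2 i3 [i1 i5 i6] [il ih]] := Ij.
  have rb := reach_straight m (isT : all straight load_body) h5.
  have jS : 7 + j <= S by lia.
  have v : m (m 2) = m0 (7 + j) by rewrite i2 il //; lia.
  have m07 : 7 <= m 0 by rewrite i0; lia.
  have := load_body_correct i1 i5 m07 v.
  move: (foldl effect m load_body) rb => m' rb /= m'E.
  have [|||m'' [r'' I'']] := IH j.+1 m'; try lia.
    split; rewrite ?m'E /= ?i0 ?i2 ?i3; try lia.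
      split.
      - by have -> : (1 == B + 8 * (6 + j)) = false by lia.
      - by have -> : (5 == B + 8 * (6 + j)) = false by lia.
      - by have -> : (6 == B + 8 * (6 + j)) = false by lia.
    split=> [x xB|i ij]; rewrite m'E.
      have -> : (x == 3) = false by lia.
      have -> : (x == 2) = false by lia.
      have -> : (x == 0) = false by lia.
      have -> : (x == m 0) = false by lia.
      have -> : (x == 4) = false by lia.
      exact: il.
    have -> : (B + 8 * i == 3) = false by lia.
    have -> : (B + 8 * i == 2) = false by lia.
    have -> : (B + 8 * i == 0) = false by lia.
    have -> : (B + 8 * i == 4) = false by lia.
    rewrite i0; case: eqP => e; first by congr m0; lia.
    by apply: ih; lia.
  exists m''; split=> //; apply: (@reach_le _ (5 + (7 * k + 1).+1).+1); first lia.
  apply: (@reach_step _ _ _ (Config 28 m)).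
    rewrite /step h4 /= i3; case: eqP => //; lia.
  by apply: reach_trans rb _; apply: reach_step r''; rewrite /step h6.
have [m6 [r4 [f0 f2 f3 [f1 f5 f6] [fl fh]]]] := loop _ 0 m5 erefl (leq0n _) I0.
have r5 := reach_straight m6 (isT : all straight load_end) h7.
have m'E x : foldl effect m6 load_end x = if x == 0 then B else if x == 4 then 0 else m6 x.
  by rewrite /= /upd /= f6 addn0.
move: (foldl effect m6 load_end) r5 m'E => m' r5 m'E.
exists m'; split.
- apply: reach_le (reach_trans r1 (reach_trans r2 (reach_trans r3 (reach_trans r4 r5)))).
  by rewrite /=; lia.
- by rewrite m'E.
- move=> j jS; rewrite m'E.
  have -> : (B + 8 * j == 0) = false by lia.
  have -> : (B + 8 * j == 4) = false by lia.
  by rewrite fh //; lia.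
Qed.

(** Offset 55 is field 7 of record 6, the output word destined for cell 7. Register 0 holds [L + 1]
    so that subtracting the target cell 7, 8, ... gives zero exactly past the last word. *)
Definition unload_setup := [:: IConst 6 1; IConst 3 0; IAdd 3 3 0; IAdd 0 13 6;
  IConst 1 55; IAdd 1 1 3; IConst 2 7; IConst 5 8].
Definition unload_body := [:: ILoad 4 1; IStore 2 4; IAdd 1 1 5; IAdd 2 2 6].
Definition unload_link := [:: ISub 0 0 6; IConst 1 47; IAdd 1 1 3; ILoad 2 1;
  IConst 1 39; IAdd 1 1 3; IAdd 1 1 0; IStore 1 2; IConst 6 7; IAdd 6 6 3].
Definition pop k := [:: ILoad k 6; IAdd 6 6 5].
Definition unload_low := pop 1 ++ pop 2 ++ pop 3 ++ pop 4 ++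
  [:: ILoad 5 6; IAdd 6 6 0; ILoad 6 6].
(* The output words 7, 8, ... are copied first, then words 1 to 6 into the
   registers in use; as the increment register is overwritten before the pointer
   register, the sixth word is also stored at a distance [L] of the fifth. *)
Definition unload off := unload_setup ++
  ISub 4 0 2 :: IJz 4 (off + 15) :: unload_body ++ IJmp (off + 8) :: unload_link ++ unload_low.

Lemma pop_correct m k a : m 6 = a -> m 5 = 8 -> 0 < k < 5 ->
  let m' := foldl effect m (pop k) in
  [/\ m' k = m a, m' 6 = a + 8, m' 5 = 8 & forall x, x != k -> x != 6 -> m' x = m x].
Proof.
move=> m6 m5 k5 m'; rewrite {}/m' /= /upd /=.
have -> : (k == 6) = false by lia.
have -> : (6 == k) = false by lia.
have -> : (5 == k) = false by lia.
rewrite eqxx m6 m5; split=> // x xk x6.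
by rewrite (negbTE x6) (negbTE xk).
Qed.

Lemma unload_low_correct m B L : m 6 = B + 7 -> m 5 = 8 -> m 0 = L -> 64 <= B ->
  let m' := foldl effect m unload_low in
  [/\ m' 0 = L, forall i, i < 5 -> m' i.+1 = m (B + 7 + 8 * i),
    m' 6 = m (B + 39 + L) & forall x, 6 < x -> m' x = m x].
Proof.
move=> m6 m5 m0 B64; rewrite /unload_low !foldl_cat.
have [p1 q1 s1 o1] := pop_correct m6 m5 (isT : 0 < 1 < 5).
move: (foldl effect m (pop 1)) p1 q1 s1 o1 => u1 p1 q1 s1 o1.
have [p2 q2 s2 o2] := pop_correct q1 s1 (isT : 0 < 2 < 5).
move: (foldl effect u1 (pop 2)) p2 q2 s2 o2 => u2 p2 q2 s2 o2.
have [p3 q3 s3 o3] := pop_correct q2 s2 (isT : 0 < 3 < 5).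
move: (foldl effect u2 (pop 3)) p3 q3 s3 o3 => u3 p3 q3 s3 o3.
have [p4 q4 s4 o4] := pop_correct q3 s3 (isT : 0 < 4 < 5).
move: (foldl effect u3 (pop 4)) p4 q4 s4 o4 => u4 p4 q4 s4 o4; set m' := foldl effect u4 _.
have high x : 6 < x -> u4 x = m x.
  by move=> x6; rewrite o4 ?o3 ?o2 ?o1 //; clear -x6; lia.
have z : u4 0 = L by rewrite o4 // o3 // o2 // o1.
have m'E x : m' x = if x == 6 then u4 (u4 6 + u4 0) else
    if x == 5 then u4 (u4 6) else u4 x.
  rewrite /m' /= /upd /= q4 z.
  have -> : (B + 7 + 8 + 8 + 8 + 8 + L == 6) = false by clear -B64; lia.
  have -> : (B + 7 + 8 + 8 + 8 + 8 + L == 5) = false by clear -B64; lia.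
  by case: (x == 6).
split.
- by rewrite m'E /= z.
- move=> i i5; rewrite m'E; have -> : (i.+1 == 6) = false by clear -i5; lia.
  have ii : i \in iota 0 5 by rewrite mem_iota.
  move: ii; rewrite !inE => /or4P[/eqP ->|/eqP ->|/eqP ->|/orP[/eqP ->|/eqP ->]] /=.
  + by rewrite o4 // o3 // o2 // p1; congr m; lia.
  + by rewrite o4 // o3 // p2 o1; [congr m; lia|clear -B64; lia|clear -B64; lia].
  + by rewrite o4 // p3 o2 ?o1; [congr m; lia| | | |]; clear -B64; lia.
  + by rewrite p4 o3 ?o2 ?o1; [congr m; lia| | | | | |]; clear -B64; lia.
  + by rewrite q4 high; [congr m; lia|clear -B64; lia].
- rewrite m'E /= q4 z high; last by clear -B64; lia.
  by congr m; lia.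
- move=> x x6; rewrite m'E; have -> : (x == 6) = false by clear -x6; lia.
  have -> : (x == 5) = false by clear -x6; lia.
  exact: high.
Qed.

Lemma unload_link_correct m B L : m 0 = L.+1 -> m 3 = B -> m 5 = 8 -> m 6 = 1 ->
  64 <= B -> let m' := foldl effect m unload_link in
  [/\ m' 0 = L, m' 5 = 8, m' 6 = B + 7
    & forall x, 6 < x -> m' x = if x == B + 39 + L then m (B + 47) else m x].
Proof.
move=> m0 m3 m5 m6 B64 m'.
have m'E x : m' x = if x == 6 then 7 + m 3 else
    if x == 39 + m 3 + (m 0 - m 6) then m (47 + m 3) else
    if x == 1 then 39 + m 3 + (m 0 - m 6) else
    if x == 2 then m (47 + m 3) else if x == 0 then m 0 - m 6 else m x.
  rewrite /m' /= /upd /=; case: (x == 6) => //=; case: (x == 1) => //=.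
have a : 39 + m 3 + (m 0 - m 6) = B + 39 + L by rewrite m3 m0 m6; lia.
have b : m 0 - m 6 = L by rewrite m0 m6; lia.
split=> [||| x x6]; rewrite m'E a.
- by have -> : (0 == B + 39 + L) = false by [clear -B64; lia].
- by have -> : (5 == B + 39 + L) = false by [clear -B64; lia].
- by rewrite /= m3 addnC.
have -> : (x == 6) = false by clear -x6; lia.
have -> : (x == 1) = false by clear -x6; lia.
have -> : (x == 2) = false by clear -x6; lia.
have -> : (x == 0) = false by clear -x6; lia.
by rewrite m3 (addnC 47).
Qed.

Lemma unload_correct P off m B L out : code_at P off (unload off) -> m 0 = B ->
  64 <= B -> m 13 = L -> L < B -> (forall j, j < L -> m (B + 8 * j + 7) = out j) ->
  exists m', [/\ reach P (8 * L + 100) (Config off m) (Config (off + 36) m'),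
    m' 0 = L & forall j, j < L -> m' j.+1 = out j].
Proof.
move=> code m0 B64 m13 LB hout.
have [h1 code1] := code_at_cat code.
have [h2 code2] := code_at_cons code1.
have [h3 code3] := code_at_cons code2.
have [h4 code4] := code_at_cat (q1 := unload_body) code3.
have [h5 code5] := code_at_cons code4.
have [h6 h7] := code_at_cat (q1 := unload_link) code5.
rewrite /= in h2 h3 h4 h5 h6 h7.
have r1 := reach_straight m (isT : all straight unload_setup) h1.
set m1 := foldl effect m _ in r1.
pose I j t := [/\ t 0 = L.+1, t 1 = B + 55 + 8 * j, t 2 = 7 + j,
  [/\ t 3 = B, t 5 = 8 & t 6 = 1] &
  (forall i, i < L -> t (B + 8 * i + 7) = out i) /\
  (forall i, 6 <= i < 6 + j -> t i.+1 = out i)].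
have I0 : I 0 m1.
  have e3 : m1 3 = B by [].
  split=> //.
  - by rewrite /m1 /= /upd /= m13 addn1.
  - by rewrite /m1 /= /upd /= m0; lia.
  - split; last by move=> i; lia.
    move=> i iL; rewrite -hout // /m1 /= /upd /=.
    have h x : x < 7 -> (B + 8 * i + 7 == x) = false by lia.
    by rewrite !h.
have loop k j t : k = L - (6 + j) -> j <= L - 6 -> I j t -> exists2 t',
    reach P (8 * k + 2) (Config (off + 8) t) (Config (off + 15) t') & I (L - 6) t'.
  elim: k j t => [|k IH] j t kE jL Ij; have [i0 i1 i2 [i3 i5 i6] [ih il]] := Ij.
    exists (upd t 4 0).
      apply: reach_step; first by rewrite /step h2.
      apply: reach_step (reach0 _ _); rewrite /step h3 /= /upd /= i0 i2.
      by have -> : L.+1 - (7 + j) = 0 by lia.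
    have <- : j = L - 6 by lia.
    split=> //; split=> i h; rewrite /upd; last by rewrite il //; case: eqP => // e; lia.
    by rewrite ih //; case: eqP => // e; lia.
  set t1 := upd t 4 (t 0 - t 2).
  have rb := reach_straight t1 (isT : all straight unload_body) h4.
  set t' := foldl effect t1 _ in rb.
  have v : t1 (t 1) = out (6 + j).
    rewrite i1 /t1 /upd; have -> : (B + 55 + 8 * j == 4) = false by lia.
    by rewrite -ih; [congr t|]; lia.
  have t'E x : t' x = if x == 2 then t 2 + 1 else if x == 1 then t 1 + 8 else
      if x == 7 + j then out (6 + j) else if x == 4 then out (6 + j) else t x.
    rewrite /t' /= /upd /= -/(t1 _) v i2 /t1 /upd /=.
    have e y : y < 7 -> (y == 7 + j) = false by lia.
    by rewrite i2 (e 2) // (e 6) // (e 1) // (e 5) // i5 i6; case: (x == 4).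
  have [|||t'' r'' I''] := IH j.+1 t'; try lia.
    split; rewrite ?t'E /= ?i0 ?i1 ?i2; try lia.
      by [].
    split=> i h; rewrite t'E.
      have e y : y < 64 -> (B + 8 * i + 7 == y) = false by lia.
      rewrite (e 2) // (e 1) // (e 4) //; case: eqP => e'; last exact: ih.
      lia.
    have -> : (i.+1 == 2) = false by lia.
    have -> : (i.+1 == 1) = false by lia.
    have -> : (i.+1 == 4) = false by lia.
    case: eqP => e; first by congr out; lia.
    by apply: il; lia.
  exists t'' => //; apply: (@reach_le _ (4 + (8 * k + 2).+1).+2); first lia.
  apply: (@reach_step _ _ _ (Config (off + 8).+1 t1)); first by rewrite /step h2.
  apply: (@reach_step _ _ _ (Config (off + 8).+2 t1)).
    rewrite /step h3 /= /t1 /upd /= i0 i2; case: eqP => //; lia.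
  by apply: reach_trans rb _; apply: reach_step r''; rewrite /step h5.
have [t r2 [f0 f1 f2 [f3 f5 f6] [fh fl]]] := loop _ 0 m1 erefl (leq0n _) I0.
have e15 : (off + 8).+2 + 4 = off + 14 by lia.
rewrite e15 -addnS in h6 h7.
have r3 := reach_straight t (isT : all straight unload_link) h6.
have [g0 g5 g6 t1E] := unload_link_correct f0 f3 f5 f6 B64.
move: (foldl effect t unload_link) r3 g0 g5 g6 t1E => t1 r3 g0 g5 g6 t1E.
have r4 := reach_straight t1 (isT : all straight unload_low) h7.
have [k0 k1 k6 kx] := unload_low_correct g6 g5 g0 B64.
move: (foldl effect t1 unload_low) r4 k0 k1 k6 kx => u r4 k0 k1 k6 kx.
exists u; split=> //.
  apply: reach_le (reach_trans r1 (reach_trans r2 (reach_trans r3 _))); last first.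
    have -> : off + 36 = (off + 15) + 10 + 11 by clear; lia.
    exact: r4.
  by rewrite /=; clear; lia.
move=> j jL; have [j5|j5] := ltnP j 5.
  rewrite k1 // t1E; last by clear -B64; lia.
  (* The extra copy of the sixth word lies [L > 0] cells beyond the fifth word, hence beyond all of
     the first five. *)
  have -> : (B + 7 + 8 * j == B + 39 + L) = false by clear -j5 jL; lia.
  by rewrite -fh //; congr t; clear; lia.
have [j6|j6] := eqVneq j 5.
  rewrite j6 k6 t1E ?eqxx; last by clear -B64; lia.
  rewrite -(fh 5); last by rewrite -j6.
  by congr t; clear; lia.
rewrite kx; last by clear -j5 j6; lia.
rewrite t1E; last by clear -j5 j6; lia.
have -> : (j.+1 == B + 39 + L) = false by clear -jL LB; lia.
by apply: fl; clear -j5 j6 jL; lia.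
Qed.

Definition main_com := Seq (Asg 2 (Minus (Get 0 (Lit 0)) (Lit 1)))
  (Seq scale (Seq find_min (Seq choose_block write_out))).

Definition price_pair (h : nat -> nat) N c g fl v i :=
  let x := block_rep fl v g (price_idx N (flat_cost c g fl v) i) in (h (x + x + 1), h (x +
    x + 2)).

Definition main_post h N s' := exists c g fl v,
  let out := out_prefix N (flat_cost c g fl v) (flat_at fl v) (price_pair h N c g fl v) N in
  [/\ forall i, i < N -> c i = scaled h N i, 0 < N -> leftmost_min N c g,
    block_choice N c g fl v, var s' 13 = size out
    & forall j, j < size out -> heap s' 7 j = nth 0 out j].

(** The command and its constant are parameters, so that [program_correct] is proved without
    unfolding the large compiled code. *)
Definition main_spec mc C := forall s N K, heap s 0 0 - 1 = N ->
  (forall j, j < N -> heap s 0 (j + j + 2) < 2 ^ K) ->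
  exec mc s ((C + 1000) * (N.+1 ^ 2 * K.+1 ^ 2)) (main_post (heap s 0) N).

Lemma exec_main : main_spec main_com (csize out_body).
Proof.
move=> s N K vN small; eapply exec_le; last first.
- apply: exec_asg_seq; set s0 := set_var _ _ _.
  have v0 : var s0 2 = N by [].
  apply: (exec_seq (exec_scale v0 small)) => s1 [c1 v1 h1].
  have v1N : var s1 2 = N by rewrite v1.
  apply: (exec_seq (exec_find_min v1N)) => s2 [g2 v2 h2].
  have v2N : var s2 2 = N by rewrite v2.
  apply: (exec_seq (exec_choose_block v2N)) => s3 [b3 v3 h3].
  have v3N : var s3 2 = N by rewrite v3.
  apply: exec_weak (leqnn _) _ (exec_write_out v3N) => s4.
  have e0 : heap s3 0 = heap s 0.
    by apply: functional_extensionality => z; rewrite h3 // h2 // h1.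
  have e1 : heap s3 1 = heap s1 1.
    by apply: functional_extensionality => z; rewrite h3 // h2.
  have e2 : heap s2 1 = heap s1 1.
    by apply: functional_extensionality => z; rewrite h2.
  rewrite e0 e1 v3 // => -[h4 h5].
  exists (heap s1 1), (var s2 9), (var s3 10 != 0), (var s3 11); split=> //.
  by rewrite -e2.
move: (csize out_body) => C; rewrite /=.
have n1 : 0 < N.+1 ^ 2 by rewrite expn_gt0.
have k1 : 0 < K.+1 ^ 2 by rewrite expn_gt0.
have nN : N.+1 <= N.+1 ^ 2 by rewrite leq_pmull.
have big : N.+1 <= N.+1 ^ 2 * K.+1 ^ 2 by apply: leq_trans nN _; rewrite leq_pmulr.
rewrite mulnDl -[400 * _ * _]mulnA; move: big; move: (N.+1 ^ 2 * K.+1 ^ 2) => X big.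
have : C * N.+1 <= C * X by rewrite leq_mul2l big orbT.
rewrite mulnDr mulnS; lia.
Qed.

Definition program mc := prelude ++ ccode 36 mc ++ unload (36 + csize mc).

Lemma main_com_wf : cwf main_com.
Proof. by vm_compute. Qed.

Lemma nth_encode n cs i : i < size cs ->
  nth 0 (encode_instance n cs) (i + i + 1) = (nth (0, 1) cs i).1 /\
  nth 0 (encode_instance n cs) (i + i + 2) = (nth (0, 1) cs i).2.
Proof.
rewrite /encode_instance addn1 addn2 /=.
elim: cs i => [|[a b] cs IH] [|i] //= h.
by rewrite addnS /=; apply: IH.
Qed.

Lemma size_encode_instance n cs : size (encode_instance n cs) = (size cs).*2.+1.
Proof. by rewrite /encode_instance /=; elim: cs => //= ab cs IH; lia. Qed.

Lemma size_encode_solution qs : size (encode_solution qs) = 4 * size qs.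
Proof. by rewrite /encode_solution; elim: qs => //= q qs IH; lia. Qed.

Lemma size_insize inp : size inp <= insize inp.
Proof. by rewrite /insize; elim: inp => [|x s IH] //=; rewrite big_cons; lia. Qed.

Lemma word_insize inp x : x \in inp -> x < 2 ^ insize inp.
Proof.
move=> xi; apply: (@leq_trans (2 ^ (trunc_log 2 x).+1)).
  by rewrite trunc_log_ltn.
rewrite leq_exp2l // /insize (big_rem x) //=; exact: leq_addr.
Qed.

Lemma program_correct mc C n cs : cwf mc -> main_spec mc C -> valid_instance n cs ->
  exists c' c g fl v h, let N := n.-1 in let fc := flat_cost c g fl v in
    let qs := [seq (tree_edge N fc (flat_at fl v) i, price_pair h N c g fl v i)
      | i <- iota 0 N & ~~ keeps_red N fc (flat_at fl v) i] in
    [/\ halts_within (program mc) (init_config (encode_instance n cs))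
          ((insize (encode_instance n cs)).+2 ^ (C + 3000)) c',
        output c' = encode_solution qs,
        forall i, i < size (encode_instance n cs) -> h i = nth 0 (encode_instance n cs) i,
        forall i, i < N -> c i = scaled h N i &
        (0 < N -> leftmost_min N c g) /\ block_choice N c g fl v].
Proof.
move=> wf spec /andP[/eqP sz _]; set inp := encode_instance n cs; set N := n.-1.
have sinp : size inp = N.*2.+1 by rewrite size_encode_instance sz.
set m0 := Defs.mem (init_config inp); pose S := size inp; pose B := 64 * S.
have code : code_at (program mc) 0 (program mc) by exists [::], [::]; rewrite cats0.
have [code1 codeX] := code_at_cat code; have [code2 code3] := code_at_cat codeX.
rewrite size_ccode -[size prelude]/36 add0n in code2 code3.
have S0 : 0 < S by rewrite /S sinp.
have Sn : S = (n + n - 7) + 6 \/ S <= 6 /\ n + n <= 7.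
  by rewrite /S sinp /N; lia.
have [m1 [r1 m10 m1h]] := prelude_correct code1 (erefl : m0 0 = S) (erefl : m0 1 = n) S0 Sn.
(* The initial state is read off the memory, so agreement is immediate; its contents are known only
   in field 0 on the input words. *)
pose s0 := State m1 (fun f i => m1 (B + 8 * i + f)).
have ag : agree B m1 s0 by split.
have B64 : 64 <= B by rewrite /B; lia.
have hw i : i < S -> heap s0 0 i = nth 0 inp i.
  by move=> iS; rewrite /= addn0 m1h.
have N0 : heap s0 0 0 - 1 = N by rewrite hw //= subn1.
have small j : j < N -> heap s0 0 (j + j + 2) < 2 ^ insize inp.
  move=> jN; have jS : j + j + 2 < S by rewrite /S sinp; lia.
  by rewrite hw //; apply: word_insize; apply: mem_nth.
have [m2 [s2 [r2 ag2 [c [g [fl [v [cE gP bP v13 h7]]]]]]]] :=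
  spec s0 N _ N0 small _ _ _ _ wf code2 B64 ag.
set out := out_prefix _ _ _ _ _ in v13 h7.
have outL : size out <= 4 * N.
  rewrite /out /out_prefix size_encode_solution leq_mul2l /= size_map size_filter.
  by apply: leq_trans (count_size _ _) _; rewrite size_iota.
have [a0 av ah] := ag2.
have m13 : m2 13 = size out by rewrite av.
have LB : size out < B by rewrite /B /S sinp; lia.
have out7 j : j < size out -> m2 (B + 8 * j + 7) = nth 0 out j.
  by move=> jL; rewrite ah // h7.
have [m3 [r3 m30 m3h]] := unload_correct code3 a0 B64 m13 LB out7.
exists (Config (36 + csize mc + 36) m3), c, g, fl, v, (heap s0 0); split=> //.
- apply: reach_halt.
    apply: reach_le (reach_trans r1 (reach_trans r2 r3)).
    have sX : N.*2.+1 <= insize inp by rewrite -sinp; apply: size_insize.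
    set X := (insize inp).+2.
    have X0 : 0 < X by [].
    have h1 : N.+1 ^ 2 * (insize inp).+1 ^ 2 <= X ^ 4.
      by rewrite (expnD X 2 2) leq_mul // leq_exp2r // /X; lia.
    have h2 : X <= X ^ 4 by rewrite -{1}[X]expn1 leq_pexp2l.
    apply: (@leq_trans ((C + 1000) * X ^ 4 + 250 * X ^ 4)).
      apply: (@leq_trans ((C + 1000) * X ^ 4 + (7 * S + 100 + (8 * size out + 100)))).
        have : (C + 1000) * (N.+1 ^ 2 * (insize inp).+1 ^ 2) <= (C + 1000) * X ^ 4.
          by rewrite leq_mul2l h1 orbT.
        by lia.
      by rewrite leq_add2l; move: h2 outL; rewrite /S sinp; move: (X ^ 4) => Y; rewrite /X;
        lia.
    (* The running time is a constant times [X ^ 4]; as [X] is at least 2, the constant is absorbed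
       into the exponent. *)
    rewrite -mulnDl; have -> : C + 3000 = C + 2996 + 4 by lia.
    rewrite expnD leq_mul2r; apply/orP; right.
    apply: (@leq_trans (2 ^ (C + 2996))); last by rewrite leq_exp2r //; lia.
    by apply: ltnW; apply: leq_ltn_trans (ltn_expl _ (ltnSn 1)); lia.
  rewrite /step nth_default //= /program !size_cat size_ccode /=; lia.
- rewrite /output [Defs.mem _]/= m30; apply: (@eq_from_nth _ 0); first by rewrite size_map
  size_iota.
  rewrite size_map size_iota => i iL.
  by rewrite (nth_map 0) ?size_iota // nth_iota // add1n m3h.
Qed.

(** * Minimum spanning trees *)

Local Open Scope ring_scope.

Section Graph.
Context {n : nat}.
Notation pair := ('I_n * 'I_n)%type.
Implicit Types (S E M K : {set pair}) (e f : pair) (x y : 'I_n).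

Definition conn S : rel 'I_n := connect (adj S).

Lemma conn_symE S : connect_sym (adj S).
Proof. by apply: sym_connect_sym => x y; rewrite /adj orbC. Qed.

Lemma conn_sym S x y : conn S x y -> conn S y x.
Proof. by rewrite /conn conn_symE. Qed.

Lemma conn_trans S y x z : conn S x y -> conn S y z -> conn S x z.
Proof. exact: connect_trans. Qed.

Lemma conn_refl S x : conn S x x.
Proof. exact: connect0. Qed.

Lemma conn_edge S e : e \in S -> conn S e.1 e.2.
Proof. by move=> eS; apply: connect1; rewrite /adj -surjective_pairing eS. Qed.

Lemma conn_gen S S' x y :
  (forall e, e \in S -> conn S' e.1 e.2) -> conn S x y -> conn S' x y.
Proof.
move=> sub; apply: connect_sub => a b /orP[|] /sub //= h.
exact: conn_sym.
Qed.

Lemma conn_mono S S' x y : S \subset S' -> conn S x y -> conn S' x y.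
Proof. by move=> /subsetP sub; apply: conn_gen => e /sub; exact: conn_edge. Qed.

Lemma conn_cut S (A : pred 'I_n) x y :
  conn S x y -> A x -> ~~ A y -> exists2 e, e \in S & A e.1 != A e.2.
Proof.
case/connectP => p pth -> {y}; elim: p x pth => [|z p IH] x /=.
  by move=> _ ->.
case/andP=> /orP xz pth Ax nA; case Az: (A z); first exact: IH pth Az nA.
by case: xz => h; [exists (x, z) | exists (z, x)]; rewrite //= Ax Az.
Qed.

Lemma conn_setU1 S e x y : conn (e |: S) x y ->
  [\/ conn S x y, conn S x e.1 /\ conn S e.2 y | conn S x e.2 /\ conn S e.1 y].
Proof.
case/connectP => p pth -> {y}; elim: p x pth => [|z p IH] x /=.
  by move=> _; constructor 1; exact: conn_refl.
case/andP=> xz /IH{IH}; move: (last z p) => y h.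
have : [\/ conn S x z, x = e.1 /\ z = e.2 | x = e.2 /\ z = e.1].
  case/orP: xz; rewrite in_setU1 => /orP[/eqP <-|h'] /=.
  - by constructor 2.
  - by constructor 1; exact: (@conn_edge S (x, z)).
  - by constructor 3.
  - by constructor 1; apply: conn_sym; exact: (@conn_edge S (z, x)).
have r1 := conn_refl S e.1; have r2 := conn_refl S e.2.
case=> [xz'|[-> ze]|[-> ze]].
- case: h => [h|[h1 h2]|[h1 h2]].
  + by constructor 1; apply: conn_trans h.
  + by constructor 2; split=> //; apply: conn_trans h1.
  + by constructor 3; split=> //; apply: conn_trans h1.
- rewrite ze in h; case: h => [h|[h1 h2]|[h1 h2]].
  + by constructor 2.
  + by constructor 2.
  + by constructor 1.
- rewrite ze in h; case: h => [h|[h1 h2]|[h1 h2]].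
  + by constructor 3.
  + by constructor 1.
  + by constructor 3.
Qed.

Lemma conn_set0 x y : conn set0 x y -> x = y.
Proof.
by case/connectP => -[|z p] //=; rewrite /adj !inE.
Qed.

(** A set of representatives of distinct components. Adding an edge merges at most two components,
    so dropping the representative joined to one of its ends, if there is one, restores
    independence. *)
Lemma independent_set S : exists X : {set 'I_n},
  (n <= #|X| + #|S|)%N /\ {in X &, forall x y, conn S x y -> x = y}.
Proof.
have [k] := ubnP #|S|; elim: k S => // k IH S ltk.
have [->|[e eS']] := set_0Vmem S.
  exists setT; rewrite cardsT card_ord cards0 addn0; split=> // x y _ _.
  exact: conn_set0.
have [X [cX iX]] : exists X : {set 'I_n},
    (n <= #|X| + #|S :\ e|)%N /\ {in X &, forall x y, conn (S :\ e) x y -> x = y}.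
  by apply: IH; move: ltk; rewrite (cardsD1 e S) eS'.
rewrite -(setD1K eS'); have : e \notin S :\ e by rewrite !inE eqxx.
move: (S :\ e) cX iX => {IH ltk eS'}S cX iX eS.
rewrite cardsU1 eS.
case: (pickP [pred x in X | conn S x e.1]) => [a /andP[/= aX ae]|no].
  exists (X :\ a); split; first by move: cX; rewrite (cardsD1 a X) aX /=; lia.
  have key x : x \in X -> x != a -> ~ conn S x e.1.
    move=> xX xa h; move/eqP: xa; apply; apply: iX => //.
    by apply: conn_trans h _; exact: conn_sym.
  move=> x y; rewrite !inE => /andP[xa xX] /andP[ya yX].
  move=> /conn_setU1[|[h _]|[_ h]]; first exact: iX.
    by case: (key x).
  by case: (key y) => //; exact: conn_sym.
exists X; split; first lia.
move=> x y xX yX /conn_setU1[|[h _]|[_ h]]; first exact: iX.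
  by have := no x; rewrite /= xX h.
by have := no y; rewrite /= yX (conn_sym h).
Qed.

Lemma card_connected S : (forall x y, conn S x y) -> (n <= #|S|.+1)%N.
Proof.
move=> con; have [X [cX iX]] := independent_set S.
apply: leq_trans cX _; rewrite -add1n leq_add2r.
by apply/card_le1_eqP=> x y xX yX; apply: iX.
Qed.

Lemma sptreeP E S : reflect [/\ S \subset E, #|S| = n.-1 & forall x y, conn S x y]
  (is_sptree E S).
Proof.
apply: (iffP and3P) => -[h1 h2 h3]; split=> //; first exact/eqP.
- by move=> x y; move/forallP: h3 => /(_ x)/forallP/(_ y).
- exact/eqP.
- by apply/forallP=> x; apply/forallP=> y; apply: h3.
Qed.

(** Spanning trees are defined by size and connectivity; acyclicity is recovered by counting, since
    [n - 2] edges cannot connect [n] vertices. *)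
Lemma sptree_bridge E S f : is_sptree E S -> f \in S -> ~~ conn (S :\ f) f.1 f.2.
Proof.
case/sptreeP => sE cS con fS; apply/negP => h.
have : (n <= #|S :\ f|.+1)%N.
  apply: card_connected => x y; apply: conn_gen (con x y) => e eS.
  have [-> //|ef] := eqVneq e f; apply: conn_edge; by rewrite !inE ef.
have := cardsD1 f S; have := ltn_ord f.1; rewrite fS cS /=.
by move: #|_| => k; lia.
Qed.

Lemma sptree_swap E S e f : is_sptree E S -> f \in S -> e \in E ->
  ~~ conn (S :\ f) e.1 e.2 -> is_sptree E (e |: S :\ f).
Proof.
move=> tS fS eE nc; case/sptreeP: (tS) => sE cS con.
have eSf : e \notin S :\ f by apply: contra nc; exact: conn_edge.
apply/sptreeP; split.
- rewrite subUset sub1set eE /=; apply: subset_trans sE; exact: subD1set.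
- by move: (cardsD1 f S); rewrite fS cardsU1 eSf -cS => ->.
set S' := e |: _.
have sub x y : conn (S :\ f) x y -> conn S' x y.
  by apply: conn_mono; exact: subsetUr.
have eS' : conn S' e.1 e.2 by apply: conn_edge; rewrite !inE eqxx.
have side x : conn (S :\ f) x f.1 \/ conn (S :\ f) x f.2.
  have := con x f.1; rewrite -{1}(setD1K fS) => /conn_setU1.
  by case=> [h|[h _]|[h _]]; [left|left|right].
have ff : conn S' f.1 f.2.
  have [h1|h1] := side e.1; have [h2|h2] := side e.2.
  - by case/negP: nc; apply: conn_trans h1 _; exact: conn_sym.
  - apply: conn_trans (sub _ _ h2); apply: conn_trans eS'.
    by apply: conn_sym; exact: sub.
  - apply: conn_sym; apply: conn_trans (sub _ _ h2); apply: conn_trans eS'.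
    by apply: conn_sym; exact: sub.
  - by case/negP: nc; apply: conn_trans h1 _; exact: conn_sym.
move=> x y; apply: conn_gen (con x y) => d dS.
have [-> //|df] := eqVneq d f; apply: sub; apply: conn_edge; by rewrite !inE df.
Qed.

(** A path that avoids one end of [f] does not use [f]. *)
Lemma conn_path_del S f v x p : (v == f.1) || (v == f.2) ->
  path (adj S) x p -> v \notin x :: p -> conn (S :\ f) x (last x p).
Proof.
move=> vf; elim: p x => [|y p IH] x /=; first by move=> _ _; exact: conn_refl.
rewrite !inE => /andP[xy pth] /norP[vx /norP[vy vp]].
apply: conn_trans (IH y pth _); last by rewrite inE negb_or vy.
apply: connect1; move: xy; rewrite /adj !inE.
have nf u u' : v != u -> v != u' -> (u, u') != f.
  by move=> h h'; apply: contraTneq vf => <- /=; rewrite negb_or h.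
by rewrite !nf.
Qed.

Lemma path_exit (T : Type) (r : rel T) (A : pred T) (x : T) p : path r x p ->
  A x -> ~~ A (last x p) ->
  exists p1 b p2, [/\ p = p1 ++ b :: p2, A (last x p1) & ~~ A b].
Proof.
elim: p x => [|y p IH] x /=; first by move=> _ ->.
case/andP=> _ pth Ax nA; case Ay: (A y); last first.
  by exists nil, y, p; rewrite Ax Ay.
have [p1 [b [p2 [-> h1 h2]]]] := IH y pth Ay nA.
by exists (y :: p1), b, p2.
Qed.

Context {R : numDomainType}.
Implicit Types w : pair -> R.

Definition light w M e : {set pair} := [set f in M | w f <= w e].

(* Exchange argument: swap an edge of S outside M for a light edge of M that
   reconnects the two sides. *)
Lemma min_sptree w E M S : (#|M| <= n.-1)%N ->
  (forall e, e \in E -> conn (light w M e) e.1 e.2) -> is_sptree E S ->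
  M \subset E -> \sum_(e in M) w e <= \sum_(e in S) w e.
Proof.
move=> cM lt tS ME.
have [k] := ubnP #|S :\: M|; elim: k S tS => // k IH S tS.
have [sE cS con] := sptreeP _ _ tS.
have [SM|] := eqVneq (S :\: M) set0.
  have -> // : M = S; apply/eqP; rewrite eq_sym eqEcard cS cM andbT.
  by rewrite -setD_eq0 SM.
case/set0Pn => f /setDP[fS fM] ltk.
have nb := sptree_bridge tS fS.
have := @conn_cut _ (conn (S :\ f) f.1) _ _ (lt f (subsetP sE _ fS)) (conn_refl _ _) nb.
case=> e; rewrite inE => /andP[eM wef] cross.
have ef : e != f by apply: contraNneq fM => <-.
have nc : ~~ conn (S :\ f) e.1 e.2.
  apply: contra cross => h; apply/eqP.
  apply/idP/idP => h'; apply: conn_trans h' _ => //; exact: conn_sym.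
have eSf : e \notin S :\ f by apply: contra nc; exact: conn_edge.
have eS : e \notin S by move: eSf; rewrite !inE ef.
have tS' := sptree_swap tS fS (subsetP ME _ eM) nc.
apply: le_trans (IH _ tS' _) _.
  apply: leq_trans _ (ltnSE ltk); apply: proper_card; apply/properP; split.
    apply/subsetP => d; rewrite !inE => /andP[dM /orP[/eqP de|/andP[_ ->]]].
      by rewrite de eM in dM.
    by rewrite dM.
  by exists f; rewrite !inE ?fM ?fS // eqxx (eq_sym f) (negbTE ef).
by rewrite big_setU1 //= [leRHS](big_setD1 f) //= lerD2r.
Qed.

(* The path of the tree joining the ends of [e] has a heavy edge [f]; as the
   path is simple, [e] reconnects the tree once [f] is removed. *)
Lemma min_sptree_light w E M e : is_sptree E M ->
  (forall S, is_sptree E S -> \sum_(d in M) w d <= \sum_(d in S) w d) ->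
  e \in E ->
  conn (light w M e) e.1 e.2.
Proof.
move=> tM minM eE; apply/negP => /negP nK.
have [ME cM con] := sptreeP _ _ tM.
have nloop f a b : conn (M :\ f) e.1 a -> conn (M :\ f) b e.2 ->
    ~~ conn (M :\ f) a b -> f \in M -> ~~ (w f <= w e) -> False.
  move=> h1 h2 nab fM wf.
  have nc : ~~ conn (M :\ f) e.1 e.2.
    apply: contra nab => h; apply: conn_trans (conn_sym h1) _.
    by apply: conn_trans h _; exact: conn_sym.
  have eMf : e \notin M :\ f by apply: contra nc; exact: conn_edge.
  have := minM _ (sptree_swap tM fM eE nc).
  rewrite big_setU1 //= (big_setD1 f fM) /= lerD2r => le.
  by rewrite le in wf.
have /connectP[p0 pth0 last0] := con e.1 e.2.
case/shortenP: pth0 last0 => p pth up _ last_p {p0}.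
rewrite last_p in nK.
have [p1 [b [p2 [pE h1 h2]]]] := path_exit pth (conn_refl _ e.1) nK.
rewrite pE in pth up last_p.
rewrite last_cat /= in last_p.
move: pth up; rewrite cat_path -cat_cons cat_uniq /=.
set a := last e.1 p1 => /and3P[pth1 ab pth2] /and3P[u1 /norP[b1 /hasPn d12] u2].
have aq : a \notin b :: p2.
  rewrite inE negb_or; apply/andP; split.
    by apply: contraNneq b1 => <-; exact: mem_last.
  by apply/negP => /d12 /=; rewrite mem_last.
have [f [fM fE wf]] : exists f, [/\ f \in M, f = (a, b) \/ f = (b, a) & ~~ (w f <= w e)].
  have heavy f : f \in M -> f = (a, b) \/ f = (b, a) -> ~~ (w f <= w e).
    move=> fM fE; apply: contra h2 => wf; apply: conn_trans h1 _.
    have /conn_edge h : f \in light w M e by rewrite inE fM.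
    by case: fE h => -> // h; exact: conn_sym.
  by case/orP: ab => h; [exists (a, b) | exists (b, a)]; split;
    rewrite ?h ?heavy //; [left|left|right|right].
have vb : (b == f.1) || (b == f.2) by case: fE => -> /=; rewrite eqxx ?orbT.
have va : (a == f.1) || (a == f.2) by case: fE => -> /=; rewrite eqxx ?orbT.
have c1 := conn_path_del vb pth1 b1; have c2 := conn_path_del va pth2 aq.
rewrite -/a in c1; rewrite -last_p in c2.
apply: (nloop f a b c1 c2 _ fM wf).
apply: contra (sptree_bridge tM fM) => {c1 c2}.
by case: fE => -> //=; apply: conn_sym.
Qed.

End Graph.

(** * Revenue of the computed solution *)

Lemma nth_index_fst (T1 T2 : eqType) (d : T1 * T2) (s : seq (T1 * T2)) q :
  uniq [seq x.1 | x <- s] -> q \in s -> nth d s (index q.1 [seq x.1 | x <- s]) = q.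
Proof.
elim: s => //= a s IH /andP[na us]; rewrite inE.
case/predU1P=> [->|qs]; first by rewrite eqxx.
case: eqP => [aq|_]; last exact: IH.
by rewrite aq map_f in na.
Qed.

Section Solution.
Variables (R : realType) (N : nat) (c : nat -> nat) (fl : pred nat).
Variables (red_cost : nat -> R) (D : R) (pq : nat -> nat * nat).
Notation n := N.+1.
Notation pair := ('I_n * 'I_n)%type.

Hypothesis flP : forall i, fl i ->
  [/\ (i.+2 < N)%N, c i.+1 = c i, c i.+2 = c i & forall j, (j < N)%N -> (c i <= c j)%N].
Hypothesis D_gt0 : 0 < D.
(** [c] will be the flattened costs, which lie below the true ones inside the block and agree with
    them on the red edges kept. *)
Hypothesis cost_ge : forall i, (i < N)%N -> (c i)%:R / D <= red_cost i.
Hypothesis cost_eq : forall i, (i < N)%N -> keeps_red N c fl i ->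
  red_cost i = (c i)%:R / D.
Hypothesis pqE : forall i, (i < N)%N ->
  (pq i).1%:R / (pq i).2%:R = (c (price_idx N c i))%:R / D.
Hypothesis pq_gt0 : forall i, (i < N)%N -> (0 < (pq i).2)%N.

Local Notation te := (tree_edge N c fl).
Local Notation kr := (keeps_red N c fl).
Local Notation pidx := (price_idx N c).

Definition solution : seq ((nat * nat) * (nat * nat)) :=
  [seq (te i, pq i) | i <- iota 0 N & ~~ kr i].

Let E (i : 'I_N) : pair := (inord (te i).1, inord (te i).2).
Let level w : {set pair} := [set E i | i : 'I_N & (c (pidx i) <= w)%N].
Let M : {set pair} := [set E i | i : 'I_N].

Lemma val_E i : (((E i).1 : nat), ((E i).2 : nat)) = te i.
Proof.
have /andP[h1 h2] := tree_edge_bound flP (ltn_ord i).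
by rewrite /= !inordK -?surjective_pairing //; lia.
Qed.

Lemma level_conn i : (i < N)%N -> conn (level (c i)) (inord i) (inord i.+1).
Proof.
move: i; apply: (links_connect flP
   (G := fun w a b => conn (level w) (inord a) (inord b))).
- by move=> w a b; exact: conn_sym.
- by move=> w a b d; exact: conn_trans.
- move=> w w' a b ww; apply: conn_mono; apply/subsetP => e /imsetP[i].
  rewrite inE => h ->; apply: imset_f; rewrite inE; exact: leq_trans ww.
- move=> i iN; apply: (@conn_edge _ _ (E (Ordinal iN))).
  by apply: imset_f; rewrite inE.
Qed.

Lemma path_conn (S : {set pair}) :
  (forall i, (i < N)%N -> conn S (inord i) (inord i.+1)) -> forall x y, conn S x y.
Proof.
move=> h; suff h0 x : conn S (inord 0) x.
  by move=> x y; apply: conn_trans (h0 y); apply: conn_sym.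
rewrite -(inord_val x); have := ltnSE (ltn_ord x).
elim: (x : nat) => [|k IH] kN; first exact: conn_refl.
by apply: conn_trans (IH (ltnW kN)) _; apply: h.
Qed.

Lemma M_conn x y : conn M x y.
Proof.
apply: path_conn => i iN; apply: conn_mono (level_conn iN).
by apply/subsetP => e /imsetP[j _ ->]; exact: imset_f.
Qed.

(** Distinctness comes from counting instead of a case analysis of [tree_edge]: the image of [N]
    indices connects [N.+1] vertices, so it has at least [N] elements. *)
Lemma E_inj : injective E.
Proof.
have cM := card_connected M_conn.
suff /imset_injP h : #|E @: 'I_N| == #|'I_N| by move=> i j; apply: h.
by rewrite eqn_leq leq_imset_card card_ord.
Qed.

Lemma card_M : #|M| = N.
Proof. by rewrite card_imset ?card_ord //; exact: E_inj. Qed.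

Lemma te_inj : {in [pred i | i < N]%N &, injective te}.
Proof.
move=> i j iN jN eq; have := @E_inj (Ordinal iN) (Ordinal jN).
by rewrite /E /= eq => /(_ erefl) [].
Qed.

Lemma solution_keys : [seq q.1 | q <- solution] = [seq te i | i <- iota 0 N & ~~ kr i].
Proof. by rewrite -map_comp. Qed.

Lemma uniq_keys : uniq [seq q.1 | q <- solution].
Proof.
rewrite solution_keys map_inj_in_uniq ?filter_uniq ?iota_uniq //.
move=> i j; rewrite !mem_filter !mem_iota /= add0n.
by move=> /andP[_ iN] /andP[_ jN]; apply: te_inj.
Qed.

Lemma solution_valid : valid_solution n solution.
Proof.
rewrite /valid_solution uniq_keys; apply/allP => q /mapP[i].
rewrite mem_filter mem_iota /= add0n => /andP[k iN] ->.
have /andP[h1 h2] := tree_edge_bound flP iN.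
by rewrite tree_edge_blue ?pq_gt0 //= ltnS h2.
Qed.

Local Notation F := (sol_F n solution).
Local Notation p := (@sol_p R n solution).

Lemma mem_F i : (E i \in F) = ~~ kr i.
Proof.
rewrite inE val_E solution_keys; apply/mapP/idP => [[j]|k].
  rewrite mem_filter mem_iota /= add0n => /andP[k jN] /te_inj h.
  by rewrite h // inE.
by exists (i : nat); rewrite // mem_filter k mem_iota /= add0n.
Qed.

Lemma F_E : F = [set E i | i : 'I_N & ~~ kr i].
Proof.
apply/setP => e; apply/idP/imsetP => [|[i]].
  rewrite inE solution_keys => /mapP[i]; rewrite mem_filter mem_iota /= add0n.
  case/andP=> k iN ee; exists (Ordinal iN); first by rewrite inE.
  have := val_E (Ordinal iN); rewrite -ee => -[/val_inj h1 /val_inj h2].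
  by rewrite [e]surjective_pairing -h1 -h2.
by rewrite inE => k ->; rewrite mem_F.
Qed.

Lemma p_E (i : 'I_N) : ~~ kr i -> p (E i) = (c (pidx i))%:R / D.
Proof.
move=> k; rewrite /sol_p val_E.
have h : (te i, pq i) \in solution.
  by apply/mapP; exists (i : nat); rewrite // mem_filter k mem_iota /= add0n.
by rewrite -[te i]/((te i, pq i).1) (nth_index_fst _ uniq_keys h) pqE.
Qed.

Lemma weight_E (i : 'I_N) : weight red_cost p (E i) = (c (pidx i))%:R / D.
Proof.
rewrite /weight; case: ifP => r; last first.
  rewrite p_E //; apply/negP => k; move/negP: r; apply.
  have := val_E i; rewrite (tree_edge_red k) /red => -[-> ->].
  exact: eqxx.
have [k|k] := boolP (kr i).
  have := val_E i; rewrite (tree_edge_red k) => -[-> _].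
  by rewrite cost_eq //; case/and4P: k => L _ _ _; rewrite /price_idx L.
have := tree_edge_blue (fl := fl) (ltn_ord i) k; rewrite -val_E /=.
by move: r; rewrite /red => /eqP ->; rewrite ltnn.
Qed.

(** By [min_sptree] it is enough to join the ends of every edge by lighter edges of [M]. Blue edges
    belong to [M]; for a red edge [level_conn] gives level [c i], which [cost_ge] bounds by the true
    cost. *)
Lemma M_mst : is_mst red_cost F p M.
Proof.
have ME : M \subset graph_edges F.
  apply/subsetP => e /imsetP[i _ ->]; rewrite in_setU mem_F inE.
  have [k|k] := boolP (kr i); last by rewrite orbT.
  by have := val_E i; rewrite (tree_edge_red k) /red => -[-> ->]; rewrite eqxx.
have tM : is_sptree (graph_edges F) M.
  by apply/sptreeP; split=> //; [exact: card_M | exact: M_conn].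
apply/andP; split=> //; apply/forallP => S; apply/implyP => tS.
apply: (@min_sptree _ _ _ (graph_edges F)) tS ME; first by rewrite card_M.
move=> e; rewrite in_setU inE => /orP[r|eF]; last first.
  apply: conn_edge; rewrite inE lexx andbT.
  by move: eF; rewrite F_E => /imsetP[i _ ->]; exact: imset_f.
have iN : (e.1 < N)%N by have := ltn_ord e.2; move: r; rewrite /red => /eqP <-; lia.
have := level_conn iN; rewrite inord_val; move: (r); rewrite /red => /eqP ->.
rewrite inord_val; apply: conn_mono; apply/subsetP => d /imsetP[j].
rewrite inE => h ->; rewrite inE imset_f //= weight_E /weight r.
apply: le_trans (cost_ge iN).
by rewrite ler_pM2r ?invr_gt0 // ler_nat.
Qed.

(** As the follower breaks ties in favour of the leader, one minimum spanning tree containing all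
    blue edges bounds the revenue from below. *)
Lemma solution_revenue :
  (\sum_(0 <= i < N) pay N c fl i)%:R / D <= revenue red_cost F p.
Proof.
rewrite /revenue.
have -> : (\sum_(0 <= i < N) pay N c fl i)%:R / D = \sum_(e in M :&: F) p e.
  have -> : M :&: F = F.
    by apply/setIidPr; rewrite F_E; apply/subsetP => e /imsetP[i _ ->]; exact: imset_f.
  rewrite F_E big_imset /=; last by move=> i j _ _; exact: E_inj.
  rewrite big_mkord natr_sum mulr_suml [RHS]big_mkcond /=; apply: eq_bigr => i _.
  rewrite inE /pay; have [k|k] := boolP (kr i); first by rewrite mul0r.
  by rewrite p_E.
by apply: le_bigmax_cond => //; exact: M_mst.
Qed.

End Solution.

(** * Upper bounds on the optimum *)

Ltac nlia := repeat match goal with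
  | H : ?T |- _ => lazymatch T with
      | is_true (leq _ _) => fail
      | @eq nat _ _ => fail
      | _ => clear H
      end
  end; lia.

Lemma sptree_swap_weight (n : nat) (R : numDomainType) (w : 'I_n * 'I_n -> R) E T e h :
  is_sptree E T -> h \in T -> e \in E -> ~~ conn (T :\ h) e.1 e.2 ->
  is_sptree E (e |: T :\ h) /\
  \sum_(d in e |: T :\ h) w d = \sum_(d in T) w d + w e - w h.
Proof.
move=> tT hT eE nc; split; first exact: sptree_swap.
have eTh : e \notin T :\ h by apply: contra nc; exact: conn_edge.
by rewrite big_setU1 //= [in RHS](big_setD1 h) //=; ring.
Qed.

Section Upper.
Variables (R : realType) (N : nat) (c : nat -> R).
Notation n := N.+1.
Notation pair := ('I_n * 'I_n)%type.
Variables (F : {set pair}) (p : pair -> R) (M : {set pair}) (g : nat).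
Hypothesis feas : feasible F p.
Hypothesis mstM : is_mst c F p M.
Hypothesis gN : (g < N)%N.
Hypothesis g_min : forall j, (j < N)%N -> c g <= c j.
Hypothesis c_ge0 : forall j, (j < N)%N -> 0 <= c j.

Let w := weight c p.
Let T0 : {set pair} := [set e | red e].
Let r (j : nat) : pair := (inord j, inord j.+1).
Let total := \sum_(0 <= j < N) c j.
Let gain := \sum_(e in M :&: F) p e.

Lemma r_red j : (j < N)%N -> red (r j).
Proof. by move=> jN; rewrite /red !inordK //; lia. Qed.

Lemma red_r (e : pair) : red e -> e = r e.1 /\ (e.1 < N)%N.
Proof.
case: e => x y; rewrite /red /r /= => /eqP xy; split.
  by rewrite xy !inord_val.
by have := ltn_ord y; rewrite -xy ltnS.
Qed.

Lemma red_cross (e : pair) h : red e -> (e.1 <= h)%N -> (h < e.2)%N -> e.1 = h :> nat.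
Proof. by rewrite /red => /eqP <-; lia. Qed.

Lemma T0E : T0 = [set r j | j : 'I_N].
Proof.
apply/setP => e; rewrite inE; apply/idP/imsetP => [/red_r[eE eN]|[j _ ->]].
  by exists (Ordinal eN).
exact: r_red.
Qed.

Lemma r_inj : injective (fun j : 'I_N => r j).
Proof.
move=> i j [/(congr1 val)]; rewrite /= !inordK; last 2 first.
- by have := ltn_ord j; lia.
- by have := ltn_ord i; lia.
by move=> h _; apply: val_inj.
Qed.

Lemma T0_tree : is_sptree (graph_edges F) T0.
Proof.
apply/sptreeP; split; first exact: subsetUl.
  by rewrite T0E card_imset ?card_ord //; exact: r_inj.
apply: path_conn => i iN; apply: (@conn_edge _ _ (r i)).
by rewrite inE r_red.
Qed.

Lemma w_red (e : pair) : red e -> w e = c e.1.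
Proof. by rewrite /w /weight => ->. Qed.

Lemma w_r j : (j < N)%N -> w (r j) = c j.
Proof. by move=> jN; rewrite w_red ?r_red //= inordK //; lia. Qed.

Lemma T0_weight : \sum_(e in T0) w e = total.
Proof.
rewrite T0E big_imset /=; last by move=> i j _ _; exact: r_inj.
by rewrite /total big_mkord; apply: eq_bigr => i _; rewrite w_r.
Qed.

Lemma F_blue e : e \in F -> [/\ (e.1.+1 < e.2)%N, 0 <= p e & w e = p e].
Proof.
move=> /feas[b p0]; split=> //; rewrite /w /weight; case: ifP => // r'.
by move: b r'; rewrite /blue /red => /[swap] /eqP ->; rewrite ltnn.
Qed.

Lemma M_tree : is_sptree (graph_edges F) M. Proof. by case/andP: mstM. Qed.

Lemma M_min S : is_sptree (graph_edges F) S -> \sum_(e in M) w e <= \sum_(e in S) w e.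
Proof. by move=> tS; case/andP: mstM => _ /forallP/(_ S)/implyP; exact. Qed.

Lemma gain_red : \sum_(e in M) w e = gain + \sum_(e in M :\: F) c e.1.
Proof.
rewrite (big_setID F) /=; congr (_ + _); apply: eq_bigr => e.
  by rewrite inE => /andP[_ /F_blue[]].
rewrite inE => /andP[eF eM]; rewrite w_red //.
by case/sptreeP: M_tree => /subsetP/(_ e eM); rewrite !inE (negbTE eF) orbF.
Qed.

Lemma MF_red e : e \in M :\: F -> red e.
Proof.
rewrite inE => /andP[eF eM].
by case/sptreeP: M_tree => /subsetP/(_ e eM); rewrite !inE (negbTE eF) orbF.
Qed.

(* The red path is a spanning tree, so it weighs at least as much as [M]. *)
Lemma gain_le_red : M :\: F != set0 -> gain <= total - c g.
Proof.
case/set0Pn => e eMF.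
have := M_min T0_tree; rewrite T0_weight gain_red (big_setD1 e) //=.
have [_ /g_min h1] := red_r (MF_red eMF).
have : 0 <= \sum_(d in (M :\: F) :\ e) c d.1.
  apply: sumr_ge0 => d; rewrite inE => /andP[_ /MF_red/red_r[_]]; exact: c_ge0.
lra.
Qed.

Lemma crossing h (S : {set pair}) x y :
  conn S x y -> (x <= h)%N -> (h < y)%N ->
  (forall e, e \in S -> (e.1 < e.2)%N) ->
  exists2 e, e \in S & (e.1 <= h < e.2)%N.
Proof.
move=> con xh hy lt.
have [||e eS cr] := @conn_cut _ _ [pred z | (nat_of_ord z <= h)%N] _ _ con.
- by rewrite /=.
- by rewrite /= -ltnNge.
exists e => //; have := lt e eS; move: cr => /=; lia.
Qed.

Section AllBlue.
Hypothesis blueM : M :\: F = set0.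

Lemma gain_sum : gain = \sum_(e in M) w e.
Proof. by rewrite gain_red blueM big_set0 addr0. Qed.

Let K := light w M (r g).

Lemma K_conn : conn K (inord g) (inord g.+1).
Proof.
apply: (min_sptree_light M_tree M_min (e := r g)).
by rewrite !inE r_red.
Qed.

Lemma K_blue e : e \in K -> [/\ e \in F, (e.1.+1 < e.2)%N, w e <= c g & e \in graph_edges F].
Proof.
rewrite inE w_r // => /andP[eM ew].
have eF : e \in F.
  by move/setP: blueM => /(_ e); rewrite !inE eM andbT => /negbFE.
by have [] := F_blue eF; split=> //; rewrite inE eF orbT.
Qed.

Lemma K_lt e : e \in K -> (e.1 < e.2)%N.
Proof. by case/K_blue => _ /ltnW. Qed.

(** On the red path [r h] is the only edge across the cut at [h], so [e] may replace it; [M] weighs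
    no more than the resulting tree. *)
Lemma red_swap h e : (h < N)%N -> e \in K -> (e.1 <= h < e.2)%N ->
  gain <= total - c h + c g.
Proof.
move=> hN eK /andP[eh he]; have [eF _ ec eE] := K_blue eK.
have rT : r h \in T0 by rewrite inE r_red.
have nc : ~~ conn (T0 :\ r h) e.1 e.2.
  apply/negP => con; have [|d] := crossing con eh he.
    by move=> d; rewrite !inE /red => /andP[_ /eqP <-].
  rewrite !inE => /andP[dr rd] /andP[d1 d2]; have [dE _] := red_r rd.
  case/eqP: dr; rewrite dE; congr (r _); exact: red_cross rd d1 d2.
have [tT sT] := sptree_swap_weight w T0_tree rT eE nc.
have := M_min tT; rewrite -gain_sum sT T0_weight w_r //; lra.
Qed.

(** Two successive exchanges. After [e] has replaced [r g.-1], the cut at [g.+1] is still crossed by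
    [r g.+1] alone, because [e] ends at [g.+1]; so [f] may replace that edge. *)
Lemma red_swap2 e f : (0 < g)%N -> (g.+1 < N)%N -> e \in K -> f \in K ->
  e.1 = g.-1 :> nat -> e.2 = g.+1 :> nat -> f.1 = g :> nat -> f.2 = g.+2 :> nat ->
  gain <= total - c g.-1 - c g.+1 + 2 * c g.
Proof.
move=> g0 g1 eK fK e1 e2 f1 f2.
have [eF _ ec eE] := K_blue eK; have [fF _ fc fE] := K_blue fK.
have gN' : (g.-1 < N)%N by nlia.
have rT : r g.-1 \in T0 by rewrite inE r_red.
have nc : ~~ conn (T0 :\ r g.-1) e.1 e.2.
  apply/negP => con; have [|||d] := crossing (h := g.-1) con; rewrite ?e1 ?e2 //; first nlia.
    by move=> d; rewrite !inE /red => /andP[_ /eqP <-].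
  rewrite !inE => /andP[dr rd] /andP[d1 d2]; have [dE _] := red_r rd.
  case/eqP: dr; rewrite dE; congr (r _); exact: red_cross rd d1 d2.
have [tT sT] := sptree_swap_weight w T0_tree rT eE nc.
have rT' : r g.+1 \in e |: T0 :\ r g.-1.
  rewrite !inE r_red // andbT; apply/orP; right; apply/negP => /eqP[/(congr1 val)] /=.
  by rewrite !inordK; nlia.
have nc' : ~~ conn ((e |: T0 :\ r g.-1) :\ r g.+1) f.1 f.2.
  apply/negP => con; have [|||d] := crossing (h := g.+1) con; rewrite ?f1 ?f2 //.
    move=> d; rewrite !inE => /andP[_ /orP[/eqP ->|/andP[_]]]; first by rewrite e1 e2; nlia.
    by rewrite /red => /eqP <-.
  rewrite !inE => /andP[dr rd] /andP[d1 d2].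
  case/orP: rd => [/eqP de|/andP[_ rd]]; first by move: d2; rewrite de e2 ltnn.
  have [dE _] := red_r rd.
  case/eqP: dr; rewrite dE; congr (r _); exact: red_cross rd d1 d2.
have [tT' sT'] := sptree_swap_weight w tT rT' fE nc'.
have := M_min tT'; rewrite -gain_sum sT' sT T0_weight !w_r //; lra.
Qed.

(* The ends of the cheapest red edge [g] are joined in [M] by edges of price at
   most [c g].  These either reach [g.+3], and then cross the cuts of the red
   edges [g.+1] and [g.+2], or symmetrically on the left, or consist of the two
   blue edges of length two around [g]. *)
Lemma gain_le_blue :
  [\/ [/\ (g.+2 < N)%N, gain <= total - c g.+1 + c g & gain <= total - c g.+2 + c g],
      [/\ (1 < g)%N, gain <= total - c g.-1 + c g & gain <= total - c g.-2 + c g]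
    | [/\ (0 < g)%N, (g.+1 < N)%N & gain <= total - c g.-1 - c g.+1 + 2 * c g]].
Proof.
have gv : (inord g : 'I_n) = g :> nat by rewrite inordK //; nlia.
have gv1 : (inord g.+1 : 'I_n) = g.+1 :> nat by rewrite inordK //; nlia.
case: (pickP [pred x : 'I_n | conn K (inord g) x && (g.+3 <= x)%N]) => [x|no].
  case/andP=> con gx; constructor 1.
  have xN := ltn_ord x.
  have key h : (g < h)%N -> (h < g.+3)%N -> gain <= total - c h + c g.
    move=> gh hg; have [|||e eK eh] := crossing (h := h) con; rewrite ?gv //; try nlia.
      exact: K_lt.
    by apply: red_swap eK eh => //; nlia.
  by split; [nlia | apply: key; nlia | apply: key; nlia].
case: (pickP [pred x : 'I_n | conn K (inord g) x && (x.+2 <= g)%N]) => [x|no'].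
  case/andP=> con gx; constructor 2.
  have key h : (g.-2 <= h)%N -> (h < g)%N -> gain <= total - c h + c g.
    move=> gh hg; have [|||e eK eh] := crossing (h := h) (conn_sym con); rewrite ?gv //;
      try nlia.
      exact: K_lt.
    by apply: red_swap eK eh => //; nlia.
  by split; [nlia | apply: key; nlia | apply: key; nlia].
have near x : conn K (inord g) x -> (g <= x.+1 /\ x < g.+3)%N.
  move=> con; have := no x; have := no' x; rewrite /= con /=; nlia.
(* Only the vertices from [g.-1] to [g.+2] are now reachable. A blue edge among them incident to [g]
   must be [(g, g.+2)], and one incident to [g.+1] must be [(g.-1, g.+1)]. *)
have [||e eK eg] := @conn_cut _ _ (pred1 (inord g)) _ _ K_conn.
- exact: eqxx.
- by apply/negP => /eqP/(congr1 val) /=; rewrite gv gv1; nlia.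
have [||f fK fg] := @conn_cut _ _ (pred1 (inord g.+1)) _ _ (conn_sym K_conn).
- exact: eqxx.
- by apply/negP => /eqP/(congr1 val) /=; rewrite gv gv1; nlia.
have ce := conn_edge eK; have cf := conn_edge fK.
have [_ be _ _] := K_blue eK; have [_ bf _ _] := K_blue fK.
have e12 : e.1 = g :> nat /\ e.2 = g.+2 :> nat.
  have [h|h] := eqVneq e.1 (inord g).
    have := near e.2; rewrite -h => /(_ ce); move: be; rewrite h gv; nlia.
  have h' : e.2 = inord g by move: eg => /=; rewrite (negbTE h); case: (e.2 =P inord g).
  have := near e.1; rewrite -h' => /(_ (conn_sym ce)); move: be; rewrite h' gv; nlia.
have f12 : f.1 = g.-1 :> nat /\ f.2 = g.+1 :> nat.
  have [h|h] := eqVneq f.2 (inord g.+1).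
    have := near f.1 (conn_trans K_conn _); rewrite -h => /(_ (conn_sym cf)).
    by move: bf; rewrite h gv1; nlia.
  have h' : f.1 = inord g.+1 by move: fg => /=; rewrite (negbTE h); case: (f.1 =P inord
    g.+1) => //; rewrite eqxx.
  have := near f.2 (conn_trans K_conn _); rewrite -h' => /(_ cf).
  by move: bf; rewrite h' gv1; nlia.
constructor 3; have f2 := f12.2; have f1 := f12.1; have e1 := e12.1; have e2 := e12.2.
have g0 : (0 < g)%N by nlia.
have g1 : (g.+1 < N)%N by have := ltn_ord e.2; nlia.
split=> //; exact: (red_swap2 g0 g1 fK eK).
Qed.

End AllBlue.
End Upper.

(** * The approximation ratio *)

Section Ratio.
Variables (N : nat) (c : nat -> nat) (g : nat) (fl : bool) (v : nat).
Hypothesis gP : leftmost_min N c g.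
Hypothesis blockP : block_choice N c g fl v.

Local Notation flat_cost := (flat_cost c g fl v).
Local Notation flat_at := (flat_at fl v).

Lemma block_chosen : fl -> [/\ block_ok N g v, (2 * block_sum c v <= 11 * c g)%N
  & forall u, block_ok N g u -> (block_sum c v <= block_sum c u)%N].
Proof. by move=> f; move: blockP; rewrite /block_choice f. Qed.

Lemma flat_atP i : flat_at i -> [/\ (i.+2 < N)%N, flat_cost i.+1 = flat_cost i,
  flat_cost i.+2 = flat_cost i & forall j, (j < N)%N -> (flat_cost i <= flat_cost j)%N].
Proof.
case/andP => f /eqP ->; have [/and3P[_ _ vN] _ _] := block_chosen f.
have fc j : (v <= j <= v.+2)%N -> flat_cost j = c g.
  by rewrite /Pricing.flat_cost /block_rep /in_block f /= => ->.
have [_ _ mn] := gP.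
split=> //; rewrite ?fc //; try lia.
by move=> j jN; rewrite /Pricing.flat_cost /block_rep; case: ifP => // _; exact: mn.
Qed.

Lemma flat_cost_le i : (i < N)%N -> (flat_cost i <= c i)%N.
Proof. rewrite /Pricing.flat_cost /block_rep; case: ifP => // _ iN.
by have [_ _] := gP; apply. Qed.

Local Notation S := (\sum_(0 <= i < N) c i)%N.
Local Notation r := (\sum_(0 <= i < N) pay N flat_cost flat_at i)%N.

(** Flattening replaces the block sum [T] by [3 * c g], so [pay_flat] yields [2 (S - T + 3 m) + 3 m]
    with [m = c g]; this is the origin of the constant 9. *)
Lemma pay_bound :
  (fl -> 2 * S + 9 * c g <= 3 * r + 2 * block_sum c v)%N /\
  (~~ fl -> 2 * S <= 3 * r + 2 * c g)%N.
Proof.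
have [gN lft mn] := gP.
split=> f; last first.
  have e i : flat_cost i = c i by rewrite /Pricing.flat_cost /block_rep /in_block (negbTE f).
  rewrite (eq_bigr flat_cost); last by move=> i _; rewrite e.
  rewrite -e; have := @pay_plain N flat_cost g gN.
  have -> : (\sum_(0 <= i < N) pay N flat_cost flat_at i
     = \sum_(0 <= i < N) pay N flat_cost pred0 i)%N.
    by apply: eq_bigr => i _; rewrite /pay /keeps_red /Pricing.flat_at /= (negbTE f).
  by apply=> j h; rewrite !e; [apply: lft|apply: mn].
have [/and3P[gv vg vN] _ _] := block_chosen f.
have fin j : (v <= j <= v.+2)%N -> flat_cost j = c g.
  by rewrite /Pricing.flat_cost /block_rep /in_block f /= => ->.
have fout j : ~~ (v <= j <= v.+2)%N -> flat_cost j = c j.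
  by rewrite /Pricing.flat_cost /block_rep /in_block f /= => /negbTE ->.
have := @pay_flat N flat_cost v (c g) vN.
have -> : (\sum_(0 <= i < N) pay N flat_cost (pred1 v) i = r)%N.
  by apply: eq_bigr => i _; rewrite /pay /keeps_red /Pricing.flat_at /= f.
move=> /(_ (fin _ _) (fin _ _) (fin _ _)) h.
have {h} : (2 * \sum_(0 <= i < N) flat_cost i + 3 * c g <= 3 * r)%N.
  apply: h; rewrite ?leqnn ?leqnSn ?leqW //.
    by move=> j jv; rewrite fout; [apply: lft|]; lia.
  move=> j jN; have [jb|jb] := boolP (v <= j <= v.+2)%N; first by rewrite fin.
  by rewrite fout //; apply: mn.
have split h := big_nat_block h vN.
rewrite (split c) (split flat_cost) !fin ?leqnn ?leqnSn ?leqW //.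
have -> : (\sum_(0 <= i < v) flat_cost i = \sum_(0 <= i < v) c i)%N.
  by apply: eq_big_nat => i h; rewrite fout //; lia.
have -> : (\sum_(v.+3 <= i < N) flat_cost i = \sum_(v.+3 <= i < N) c i)%N.
  by apply: eq_big_nat => i h; rewrite fout //; lia.
rewrite /block_sum; clear; lia.
Qed.

(** No red edge of the block is kept: its first edge is covered by [flat_at], and the other two have
    an equally cheap left neighbour. Hence lowering the costs never misstates the weight of a red
    tree edge. *)
Lemma flat_red i : (i < N)%N -> keeps_red N flat_cost flat_at i -> flat_cost i = c i.
Proof.
move=> iN /and4P[L _ _ nf]; rewrite /Pricing.flat_cost /block_rep; case: ifP => // ib.
have [gN lft mn] := gP.
move: (ib); rewrite /in_block => /and3P[f vi iv].
have [/and3P[gv vg vN] _ _] := block_chosen f.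
have fin j : (v <= j <= v.+2)%N -> flat_cost j = c g.
  by rewrite /Pricing.flat_cost /block_rep /in_block f /= => ->.
have iv' : i != v by move: nf; rewrite /Pricing.flat_at /= f.
have l : less N flat_cost i.-1 i by rewrite /less !fin; lia.
by move: L; rewrite /local_min l andbF.
Qed.

End Ratio.

Section Combine.
Variables (R : realType) (N : nat) (c : nat -> nat) (g : nat) (fl : bool) (v : nat).
Variables (cs : seq (nat * nat)) (D : R).
Hypothesis gP : leftmost_min N c g.
Hypothesis blockP : block_choice N c g fl v.
Hypothesis D_gt0 : 0 < D.
Hypothesis cs_size : size cs = N.
Hypothesis cs_pos : all (fun ab => (0 < ab.2)%N) cs.
Hypothesis cost_c : forall i, (i < N)%N -> cost_of cs i = (c i)%:R / D.

Local Notation fc := (flat_cost c g fl v).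
Local Notation fa := (flat_at fl v).
Definition out_price i := nth (0, 1)%N cs (block_rep fl v g (price_idx N fc i)).
Definition out_solution := solution N fc fa out_price.

Lemma block_rep_lt i : (i < N)%N -> (block_rep fl v g i < N)%N.
Proof. by rewrite /block_rep; case: ifP => // _ _; case: gP. Qed.

Lemma out_price_gt0 i : (i < N)%N -> (0 < (out_price i).2)%N.
Proof.
move=> iN; apply: (allP cs_pos); apply: mem_nth.
by rewrite cs_size block_rep_lt ?price_idx_lt.
Qed.

Lemma out_priceE i : (i < N)%N ->
  (out_price i).1%:R / (out_price i).2%:R = (fc (price_idx N fc i))%:R / D.
Proof.
move=> iN; have h := block_rep_lt (price_idx_lt fc iN).
by have := cost_c h; rewrite /cost_of => ->.
Qed.

Lemma out_valid : valid_solution N.+1 out_solution.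
Proof.
apply: solution_valid (flat_atP gP blockP) _ => i; exact: out_price_gt0.
Qed.

Lemma out_revenue : (\sum_(0 <= i < N) pay N fc fa i)%:R / D
  <= revenue (cost_of cs) (sol_F N.+1 out_solution) (@sol_p R _ out_solution).
Proof.
apply: solution_revenue => //.
- exact: flat_atP.
- by move=> i iN; rewrite cost_c // ler_pM2r ?invr_gt0 // ler_nat (flat_cost_le fl v gP iN).
- by move=> i iN k; rewrite cost_c // (flat_red gP blockP iN k).
- exact: out_priceE.
Qed.

(* The three cases of [gain_le_blue] are matched with the blocks starting at
   [g], [g.-2] and [g.-1]. *)
Lemma out_ratio (F : {set 'I_N.+1 * 'I_N.+1}) p : feasible F p ->
  revenue (cost_of cs) F p <= 3 / 2 *
  revenue (cost_of cs) (sol_F N.+1 out_solution) (@sol_p R _ out_solution).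
Proof.
move=> feas; apply: le_trans (_ : 3 / 2 * ((\sum_(0 <= i < N) pay N fc fa i)%:R / D) <= _);
  last first.
  by rewrite ler_pM2l ?out_revenue //; lra.
set r := (\sum_(0 <= i < N) pay N fc fa i)%N.
apply: bigmax_le => [|M mstM].
  by rewrite mulr_ge0 ?divr_ge0 ?ler0n ?(ltW D_gt0) //; lra.
have [gN lft mn] := gP.
have gmin j : (j < N)%N -> cost_of cs g <= cost_of cs j :> R.
  by move=> jN; rewrite !cost_c // ler_pM2r ?invr_gt0 // ler_nat mn.
have c0 j : (j < N)%N -> 0 <= cost_of cs j :> R.
  by move=> jN; rewrite cost_c // divr_ge0 ?ler0n ?(ltW D_gt0).
have tot : \sum_(0 <= j < N) cost_of cs j = (\sum_(0 <= j < N) c j)%N%:R / D :> R.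
  by rewrite natr_sum mulr_suml; apply: eq_big_nat => i /andP[_ iN]; rewrite cost_c.
have := pay_bound gP blockP; rewrite -/r.
set S := (\sum_(0 <= j < N) c j)%N in tot *; set x := \sum_(e in _) _ => bnd.
rewrite mulrA ler_pdivlMr //.
have scale (y : R) : x <= y -> x * D <= y * D by rewrite ler_pM2r.
have nr (y : nat) : y%:R / D * D = y%:R by rewrite mulfVK ?gt_eqF.
suff h : 2 * (x * D) <= 3 * r%:R by move: h; lra.
have m0 : 0 <= (c g)%:R :> R by rewrite ler0n.
(* If a block was flattened, its sum is minimal, so its guarantee implies the one for every block
   [u], and [2 T <= 11 m] makes it imply the plain bound too. If none was, every block lies above
   the threshold. *)
have [bnd1 bnd2] : 2 * S%:R <= 3 * r%:R + 2 * (c g)%:R :> R /\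
    forall u, block_ok N g u ->
    2 * S%:R - 2 * (block_sum c u)%:R + 9 * (c g)%:R <= 3 * r%:R :> R \/
    11 * (c g)%:R <= 2 * (block_sum c u)%:R :> R.
  case: bnd => bt bf; have [f|f] : fl \/ ~~ fl by case: (fl); [left|right].
    have h1 := bt f; have [_ h2 h3] := block_chosen blockP f.
    have h1' : 2 * S%:R + 9 * (c g)%:R <= 3 * r%:R + 2 * (block_sum c v)%:R :> R.
      by rewrite -!natrM -!natrD ler_nat.
    have h2' : 2 * (block_sum c v)%:R <= 11 * (c g)%:R :> R by rewrite -!natrM ler_nat.
    split=> [|u /h3]; first by lra.
    by rewrite -(ler_nat R) => h4; left; lra.
  have h1 := bf f; move: blockP; rewrite /block_choice (negbTE f) => h2.
  split=> [|u /h2 /ltnW h3]; last by right; rewrite -!natrM ler_nat.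
  by rewrite -!natrM -!natrD ler_nat.
have [e0|/(gain_le_red feas mstM gN gmin c0)] := eqVneq (M :\: F) set0; last first.
  by rewrite tot cost_c // => /scale; rewrite mulrBl !nr; lra.
have := gain_le_blue feas mstM gN e0; rewrite tot -/x.
case=> [[g2 h1 h2]|[g1 h1 h2]|[g0 g1 h]].
(* With [m = c g] and block sum [T], and costs scaled by [D], adding the two bounds gives
   [2 x <= 2 S - T + 3 m]. This is at most [2 S - 2 T + 9 m] if [T <= 6 m], and at most [2 S - 2 m]
   if [T >= 5 m]; the threshold [11 m / 2] lies between. *)
- move: h1 h2; rewrite !cost_c //; last lia.
  move=> /scale h1 /scale h2; move: h1 h2; rewrite !mulrDl !mulNr !nr => h1 h2.
  have /bnd2 : block_ok N g g by rewrite /block_ok; lia.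
  rewrite /block_sum !natrD; case=> h; lra.
- move: h1 h2; rewrite !cost_c //; try lia.
  move=> /scale h1 /scale h2; move: h1 h2; rewrite !mulrDl !mulNr !nr => h1 h2.
  have /bnd2 : block_ok N g g.-2 by rewrite /block_ok; lia.
  have -> : block_sum c g.-2 = (c g.-2 + (c g.-1 + c g))%N.
    by rewrite /block_sum; case: (g) g1 => [|[|k]].
  rewrite !natrD; case=> h; lra.
- move: h; rewrite !cost_c //; try lia.
  move=> /scale; rewrite !mulrDl !mulNr !mul1r !nr => h.
  have /bnd2 : block_ok N g g.-1 by rewrite /block_ok; lia.
  have -> : block_sum c g.-1 = (c g.-1 + (c g + c g.+1))%N.
    by rewrite /block_sum; case: (g) g0 => [|k].
  rewrite !natrD; case=> h'; lra.
Qed.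

End Combine.

Section RealSide.
Variable R : realType.

Lemma scaled_cost cs (h : nat -> nat) N i : size cs = N ->
  all (fun ab => (0 < ab.2)%N) cs ->
  (forall j, (j < N)%N -> h (j + j + 1)%N = (nth (0, 1)%N cs j).1 /\
     h (j + j + 2)%N = (nth (0, 1)%N cs j).2) -> (i < N)%N ->
  cost_of cs i = (scaled h N i)%:R / (\prod_(0 <= j < N) h (j + j + 2))%N%:R :> R.
Proof.
move=> sz pos hE iN; have pj j : (j < N)%N -> (0 < h (j + j + 2))%N.
  by move=> jN; rewrite (hE j jN).2; apply: (allP pos); rewrite mem_nth ?sz.
rewrite /cost_of /scaled (hE i iN).1; set ab := nth _ _ _.
have -> : (\prod_(0 <= j < N) h (j + j + 2) =
    ab.2 * \prod_(0 <= j < N | j != i) h (j + j + 2))%N.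
  rewrite !big_mkord (bigD1 (Ordinal iN)) //= (hE i iN).2; congr (_ * _)%N.
set q := (\prod_(0 <= j < N | j != i) _)%N.
have q0 : q%:R != 0 :> R.
  rewrite pnatr_eq0 -lt0n /q big_mkord; apply: prodn_cond_gt0 => j _; exact: pj.
have b0 : ab.2%:R != 0 :> R.
  by rewrite pnatr_eq0 -lt0n -(hE i iN).2 pj.
by rewrite !natrM; field; rewrite q0 b0.
Qed.

Lemma revenue_ge0 n (c : nat -> R) (F : {set 'I_n * 'I_n}) p : 0 <= revenue c F p.
Proof. exact: bigmax_ge_id. Qed.

Lemma revenue_small n (c : nat -> R) (F : {set 'I_n * 'I_n}) p :
  n.-1 = 0%N -> revenue c F p <= 0.
Proof.
move=> n1; apply: bigmax_le => // S /andP[/sptreeP[_ cS _] _].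
have -> : S = set0 by apply/eqP; rewrite -cards_eq0 cS n1.
by rewrite set0I big_set0.
Qed.

End RealSide.

Theorem theorem3 (R : realType) (eps : R) :
  0 < eps ->
  exists (P : seq instr) (k : nat),
    forall (n : nat) (cs : seq (nat * nat)),
      @valid_instance n cs ->
      exists (c' : config) (qs : seq ((nat * nat) * (nat * nat))),
        [/\ halts_within P (init_config (encode_instance n cs))
              ((insize (encode_instance n cs)).+2 ^ k) c',
            output c' = encode_solution qs,
            @valid_solution n qs &
            forall (F : {set 'I_n * 'I_n}) (p : 'I_n * 'I_n -> R),
              feasible F p ->
              revenue (cost_of cs) F p <=
              (3 / 2 + eps) * revenue (cost_of cs) (@sol_F n qs) (@sol_p R n qs)].
Proof.
move=> eps0; exists (program main_com), (csize out_body + 3000)%N => n cs vi.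
have [c' [c [g [fl [v [h [halt out hE cE [gP bP]]]]]]]] := program_correct main_com_wf
  exec_main vi.
exists c'; set N := n.-1 in out cE gP bP.
case/andP: (vi) => /eqP sz pos.
set qs := [seq _ | i <- _ & _] in out.
(* With at most one vertex there is no cheapest edge [g]; spanning trees are then empty and every
   revenue is zero. *)
exists qs; case: (posnP N) => [N0|Npos].
  have qs0 : qs = [::] by rewrite /qs N0.
  split=> //; first by rewrite qs0.
  move=> F p _; apply: le_trans (revenue_small _ _ _ N0) _.
  by rewrite mulr_ge0 ?revenue_ge0 // addr_ge0 ?(ltW eps0) // divr_ge0.
have gN := gP Npos.
have hcs j : (j < N)%N -> h (j + j + 1)%N = (nth (0, 1)%N cs j).1 /\
     h (j + j + 2)%N = (nth (0, 1)%N cs j).2.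
  move=> jN; have jcs : (j < size cs)%N by rewrite sz.
  have [h1 h2] := nth_encode n jcs.
  by rewrite -h1 -h2 !hE // size_encode_instance sz -/N; lia.
set D := (\prod_(0 <= j < N) h (j + j + 2))%N.
have D0 : (0 < D)%N.
  rewrite /D big_mkord; apply: prodn_gt0 => j.
  by rewrite (hcs j (ltn_ord j)).2; apply: (allP pos); rewrite mem_nth ?sz.
have D0R : 0 < D%:R :> R by rewrite ltr0n.
have cost i : (i < N)%N -> cost_of cs i = (c i)%:R / D%:R :> R.
  by move=> iN; rewrite (scaled_cost R sz pos hcs iN) cE.
have qsE : qs = out_solution N c g fl v cs.
  apply/eq_in_map => i; rewrite mem_filter mem_iota /= add0n => /andP[_ iN].
  congr (_, _); rewrite /price_pair /out_price.
  have xN := block_rep_lt fl v gN (price_idx_lt (flat_cost c g fl v) iN).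
  by rewrite (hcs _ xN).1 (hcs _ xN).2 -surjective_pairing.
have nE : n = N.+1 by rewrite /N; lia.
clearbody N; subst n; split=> //; rewrite qsE.
  exact: (out_valid gN bP sz pos).
move=> F p feas.
apply: le_trans (out_ratio gN bP D0R sz pos cost feas) _.
by rewrite ler_wpM2r ?revenue_ge0 // lerDl ltW.
Qed.
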